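(* For all $n\ge 1$ and all $0\le t_1<\cdots<t_n<2\pi$, the random vector $\lambda^2\bigl(d_\lambda(t_1,\cdot),\ldots,d_\lambda(t_n,\cdot)\bigr)$ converges almost surely, as $\lambda\to+\infty$, towards $\bigl(Z(t_1,\cdot),\ldots,Z(t_n,\cdot)\bigr)$, where $$Z(t,\omega)=-\frac{L(t,\omega)^2}{2}\,\frac{\cos\bigl(2(\Theta(t,\omega)-t)\bigr)}{R(t,\omega)\cos(\Theta(t,\omega)-t)}.$$
   Context: Let $\mu$ be a probability measure on $\mathbb{R}_+$ with $\int R\,\mathrm{d}\mu(R)=1$, $\int R^2\,\mathrm{d}\mu(R)<+\infty$ and $\mu((R_\star,+\infty))=1$ for some $R_\star>0$. Let $\mathbf{Z}$ be a Poisson point process on $\mathbb{R}_+\times[0,2\pi)\times\mathbb{R}_+$ with intensity measure $\mathrm{d}\rho\,\mathrm{d}\theta\,\mathrm{d}\mu(R)$; everything below is built from this single process, simultaneously for all $\lambda>0$. Line process and Crofton cell: to each $(\rho,\theta,R)\in\mathbf{Z}$ associate the line $D_{\rho,\theta}=\{x\in\mathbb{R}^2:\ x_1\cos\theta+x_2\sin\theta=\rho\}$. The Crofton cell $\mathcal{C}$ is the closed (almost surely bounded) convex polygon containing $0$ which is the closure of the connected component containing $0$ of the complement of the union of these lines. Coupled disc model: let $\psi_\lambda(\rho,R)=R\sqrt{1+2\rho/(\lambda^2R)}$. To each $(\rho,\theta,R)\in\mathbf{Z}$ associate the open disc of radius $R$ whose centre has polar coordinates $(\psi_\lambda(\rho,R),\theta)$,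 and let $\mathcal{O}_\lambda$ be the union of these discs (it does not contain $0$). Let $D_0^\lambda$ be the connected component of $\mathbb{R}^2\setminus\mathcal{O}_\lambda$ containing $0$, and let $D^\lambda=\lambda^2D_0^\lambda$ if this set is bounded, $D^\lambda=K_0$ (a given fixed compact set) otherwise. For $t\in[0,2\pi)$ let $\Delta_t$ be the open half-line from $0$ in direction $t$. Let $(\Upsilon(t),\Theta(t),R(t))\in\mathbf{Z}$ be the marked point whose line supports the edge of $\mathcal{C}$ intersected by $\Delta_t$ ($\Upsilon(t)$ is the distance from $0$ to the line, $\Theta(t)$ its polar angle, $R(t)$ the associated radius), and let $L(t)=\Upsilon(t)/\cos(\Theta(t)-t)$ be the distance from $0$ to the intersection of $\Delta_t$ with this edge. The defect at angle $t$ is $$d_\lambda(t)=\operatorname{dist}(0,\Delta_t\cap\partial D^\lambda)-\operatorname{dist}(0,\Delta_t\cap\partial\mathcal{C}),$$ with $\operatorname{dist}$ the Euclidean distance. *)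

(* Defs.v *)
From HB Require Import structures.
From mathcomp Require Import all_boot all_order all_algebra.
From mathcomp Require Import all_classical all_reals all_analysis.
From mathcomp Require Import measurable_realfun.

Set Implicit Arguments.
Unset Strict Implicit.
Unset Printing Implicit Defensive.

Import Order.TTheory GRing.Theory Num.Theory.
Import numFieldTopology.Exports numFieldNormedType.Exports.

Local Open Scope classical_set_scope.
Local Open Scope ring_scope.

Definition mutually_independent (R : realType) (d d' : measure_display)
    (Omega : measurableType d) (T : measurableType d')
    (P : probability Omega R) (n : nat) (X : 'I_n -> Omega -> T) : Prop :=
  (* subfamilies are covered by taking E i = setT *)
  forall E : 'I_n -> set T, (forall i, measurable (E i)) ->
    fine (P (\bigcap_(i in [set: 'I_n]) (X i @^-1` E i))) =
    \prod_(i < n) fine (P (X i @^-1` E i)).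

(* Poisson law of mean m in [0, +oo], the law of mean +oo being the Dirac mass
   at +oo.  The second argument of [poisson_prob] is a dummy; [poisson_pmf] is
   avoided because it takes the value 1 for every k when the rate is 0. *)
Definition has_poisson_law (R : realType) (d : measure_display)
    (Omega : measurableType d) (P : probability Omega R)
    (N : Omega -> \bar R) (m : \bar R) : Prop :=
  (forall r : R, m = r%:E -> forall k : nat,
      P (N @^-1` [set k%:R%:E]) = poisson_prob r 0 [set k]) /\
  (m = +oo%E -> P (N @^-1` [set +oo%E]) = 1%E).

Definition nb_points (R : realType) (T : choiceType) (Omega : Type)
    (Z : Omega -> set T) (B : set T) (w : Omega) : \bar R :=
  counting (Z w `&` B).

(* A Poisson point process on the measurable set S with intensity (the trace on
   S of) nu, seen as a random countable subset of S.  Multiple points need not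
   be encoded when nu has no atoms. *)
Record poisson_process_on (R : realType) (d d' : measure_display)
    (Omega : measurableType d) (T : measurableType d')
    (P : probability Omega R) (S : set T) (nu : set T -> \bar R)
    (Z : Omega -> set T) : Prop := PoissonProcessOn {
  ppp_sub : forall w, Z w `<=` S ;
  ppp_countable : forall w, countable (Z w) ;
  ppp_measurable : forall B, measurable B -> B `<=` S ->
    measurable_fun setT (nb_points R Z B) ;
  ppp_poisson : forall B, measurable B -> B `<=` S ->
    has_poisson_law P (nb_points R Z B) (nu B) ;
  ppp_indep : forall (n : nat) (B : 'I_n -> set T),
    (forall i, measurable (B i)) -> (forall i, B i `<=` S) ->
    trivIset setT B ->
    mutually_independent P (fun i => nb_points R Z (B i)) }.

Section geometry.
Context {R : realType}.
Implicit Types (rho theta t r lambda : R) (x : R * R) (A : set (R * R)).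

(* The norm of the normed module R * R is the sup norm. *)
Definition enorm x : R := Num.sqrt (x.1 ^+ 2 + x.2 ^+ 2).

Definition polar r theta : R * R := (r * cos theta, r * sin theta).

Definition boundary A : set (R * R) := closure A `\` interior A.

(* inf set0 = 0 *)
Definition dist0 A : R := inf [set enorm x | x in A].

Definition half_line t : set (R * R) := [set polar r t | r in [set r | 0 < r]].

(* A marked point (rho, theta, r) is z with rho = z.1.1, theta = z.1.2 and
   r = z.2. *)
Definition mark_space : set (R * R * R) :=
  (`[0, +oo[ `*` `[0, pi *+ 2[) `*` `[0, +oo[.

Definition intensity (mu : probability (measurableTypeR R) R) :
    set (R * R * R) -> \bar R :=
  ((lebesgue_measure \x lebesgue_measure) \x mu)%E.

Definition line rho theta : set (R * R) :=
  [set x | x.1 * cos theta + x.2 * sin theta = rho].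

Definition half_plane rho theta : set (R * R) :=
  [set x | x.1 * cos theta + x.2 * sin theta <= rho].

Definition crofton_cell (C : set (R * R * R)) : set (R * R) :=
  closure (connected_component
    (~` \bigcup_(z in C) line z.1.1 z.1.2) (0 : R * R)).

Definition psi lambda rho r : R :=
  r * Num.sqrt (1 + 2 * rho / (lambda ^+ 2 * r)).

Definition disc lambda rho theta r : set (R * R) :=
  [set x | enorm (x - polar (psi lambda rho r) theta) < r].

Definition covered lambda (C : set (R * R * R)) : set (R * R) :=
  \bigcup_(z in C) disc lambda z.1.1 z.1.2 z.2.

Definition component0 lambda (C : set (R * R * R)) : set (R * R) :=
  connected_component (~` covered lambda C) (0 : R * R).

Definition scaled_component (K0 : set (R * R)) lambda (C : set (R * R * R)) :
    set (R * R) :=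
  if `[< bounded_set (component0 lambda C) >]
  then [set lambda ^+ 2 *: x | x in component0 lambda C] else K0.

(* The line of z supports an edge (a nondegenerate segment) of the Crofton cell
   and this edge meets the open half-line of direction t. *)
Definition supports_edge_at (C : set (R * R * R)) t (z : R * R * R) : Prop :=
  let edge := line z.1.1 z.1.2 `&` crofton_cell C in
  [/\ crofton_cell C `<=` half_plane z.1.1 z.1.2,
      exists x y, [/\ x != y, edge x & edge y] &
      edge `&` half_line t !=set0].

Definition edge_mark (C : set (R * R * R)) t : R * R * R :=
  xget (0, 0, 0) [set z | C z /\ supports_edge_at C t z].

Definition Upsilon (C : set (R * R * R)) t : R := (edge_mark C t).1.1.
Definition Theta (C : set (R * R * R)) t : R := (edge_mark C t).1.2.
Definition Radius (C : set (R * R * R)) t : R := (edge_mark C t).2.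

Definition L (C : set (R * R * R)) t : R :=
  Upsilon C t / cos (Theta C t - t).

Definition defect (K0 : set (R * R)) lambda (C : set (R * R * R)) t : R :=
  dist0 (half_line t `&` boundary (scaled_component K0 lambda C)) -
  dist0 (half_line t `&` boundary (crofton_cell C)).

Definition Zlim (C : set (R * R * R)) t : R :=
  - (L C t ^+ 2 / 2) *
    (cos (2 * (Theta C t - t)) / (Radius C t * cos (Theta C t - t))).

End geometry.

(* Main.v *)
Require Import Defs.
From HB Require Import structures.
From mathcomp Require Import all_boot all_order all_algebra.
From mathcomp Require Import all_classical all_reals all_analysis.
From mathcomp Require Import measurable_realfun.
From mathcomp Require Import finmap ring lra.

(** The convergence is deterministic: it holds for every configuration of
marks that has a few regularity properties, and the Poisson process has
these properties almost surely.

Write e_theta for the unit vector of angle theta.  For a mark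
(rho, theta, r), psi ^ 2 - r ^ 2 = 2 rho r / lambda ^ 2, so the disc of this
mark, scaled by lambda ^ 2, is the set of the points y such that
  |y|^2 / lambda^2 - 2 psi <y, e_theta> + 2 rho r < 0
([disc_form], [scaled_disc]).  As lambda grows, psi tends to r and the disc
becomes the half-plane <y, e_theta> > rho behind the line of the mark.  On
the ray of direction t, with c = cos (theta - t) > 0, the line is met at
distance L = rho / c and the disc at the smaller root s of
  s^2 / lambda^2 - 2 psi c s + 2 rho r = 0.
Since psi - r = 2 rho r / (lambda^2 (psi + r)), this equation gives
  lambda^2 (s - L) = (s^2 - 4 c rho r s / (psi + r)) / (2 r c),
and s tends to L, psi to r: the limit is (L^2 - 2 c rho L) / (2 r c), which
is - L^2 cos (2 (theta - t)) / (2 r c) because rho = L c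
([cvg_scaled_gap]).

It remains to see that both distances of the defect are governed by the same
mark, the one whose line is hit first by the ray.  The Crofton cell is the
intersection of the half-planes of all the lines ([crofton_cellE]), so its
boundary is at distance L on the ray ([dist0_crofton]).  For the disc model,
three things are needed for all large lambda.  The component of 0 is
bounded: marks with angles close to the four axis directions block a whole
square around 0 ([near_bounded_component0]).  The other discs do not reach
the part of the ray before s: marks with a large rho are far from 0 uniformly
in lambda >= 1 when the radii are bounded below ([disc_form_far]), and only
finitely many marks are left, each of which is hit later than L in the limit
([near_free_others]).  Finally a neighbourhood of each point of the ray before
s lies in the component, being joined to 0 along the ray
([scaled_component0_interior]), while the points just after s are covered.

The almost sure properties only involve the number of points in a given set.
A set of zero, finite or infinite intensity almost surely contains no,
finitely many or at least one point.  That no two lines are hit at the same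
distance ([ae_generic_direction]) is the bound P(N >= 2) <= m^2 for a Poisson
variable N of mean m, applied to the strips of marks hit at a distance
between j / k and (j + 1) / k: up to a given distance there are O(k) strips of
intensity O(1 / k), hence a tie has probability O(1 / k). *)

Set Implicit Arguments.
Unset Strict Implicit.
Unset Printing Implicit Defensive.

Import Order.TTheory GRing.Theory Num.Theory.
Import numFieldTopology.Exports numFieldNormedType.Exports.

Local Open Scope classical_set_scope.
Local Open Scope ring_scope.

(** * Rays, segments and boundaries in the plane *)
Section plane.
Context {R : realType}.
Implicit Types (theta t s : R) (x y : R * R) (A : set (R * R)).

(** The coordinate along the unit vector of angle [theta], which is the
    expression occurring in [line] and [half_plane]. *)
Definition dircoord theta x : R := x.1 * cos theta + x.2 * sin theta.

Lemma dircoord_polar theta s t :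
  dircoord theta (polar s t) = s * cos (theta - t).
Proof. by rewrite /dircoord /polar /= cosB; ring. Qed.

Lemma dircoordZ theta s x : dircoord theta (s *: x) = s * dircoord theta x.
Proof. by rewrite /dircoord /= /GRing.scale /=; ring. Qed.

Lemma dircoordD theta x y :
  dircoord theta (x + y) = dircoord theta x + dircoord theta y.
Proof. by rewrite /dircoord /=; ring. Qed.

Lemma dircoord0 theta : dircoord theta (0 : R * R) = 0.
Proof. by rewrite /dircoord /= !mul0r addr0. Qed.

Lemma polarZ a s t : a *: polar s t = polar (a * s) t :> R * R.
Proof. by congr pair; exact: mulrA. Qed.

Lemma fst_norm_le x : `|x.1| <= `|x|.
Proof. by rewrite prod_normE le_max lexx. Qed.

Lemma snd_norm_le x : `|x.2| <= `|x|.
Proof. by rewrite prod_normE le_max lexx orbT. Qed.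

Lemma dircoord_norm_le theta x : `|dircoord theta x| <= 2 * `|x|.
Proof.
rewrite (le_trans (ler_normD _ _))// !normrM.
have h1 : `|x.1| * `|cos theta| <= `|x|.
  by rewrite -[leRHS]mulr1 ler_pM ?fst_norm_le// cos_max.
have h2 : `|x.2| * `|sin theta| <= `|x|.
  by rewrite -[leRHS]mulr1 ler_pM ?snd_norm_le// sin_max.
lra.
Qed.

Lemma continuous_dircoord theta : continuous (dircoord theta : R * R -> R).
Proof.
move=> x; apply: cvgD; apply: cvgMr_tmp.
- exact: cvg_fst.
- exact: cvg_snd.
Qed.

Lemma enorm_polar s t : enorm (polar s t) = `|s|.
Proof.
by rewrite /enorm /polar /= !exprMn -mulrDr cos2Dsin2 mulr1 sqrtr_sqr.
Qed.

Lemma continuous_ray t : continuous (polar ^~ t : R -> R * R).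
Proof.
move=> s; have h (a : R) : (fun e => e * a) @ s --> s * a.
  by apply: cvgMr_tmp; exact: cvg_id.
exact: cvg_pair (h _) (h _).
Qed.

(** The image of a connected set under a continuous real function is an
    interval. This bounds both the Crofton cell, which does not cross a line,
    and the component of the disc model, which does not cross a covered
    square. *)
Lemma connected_below (T : topologicalType) (A : set T) (f : T -> R) (a : T) m :
  connected A -> continuous f -> A a -> f a < m ->
  (forall b, A b -> f b != m) -> forall b, A b -> f b < m.
Proof.
move=> cA cf Aa fam fm x Ax; rewrite ltNge; apply/negP => mfx.
have /connected_intervalP iA : connected (f @` A).
  by apply: connected_continuous_connected => //; exact: continuous_subspaceT.
have [y Ay fy] : (f @` A) m.
  apply: (iA (f a) (f x)); [by exists a|by exists x|by rewrite (ltW fam) mfx].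
by have := fm y Ay; rewrite fy eqxx.
Qed.

Lemma segment_in_component A x y :
  (forall s, 0 <= s <= 1 -> A (x + s *: (y - x))) ->
  connected_component A x y.
Proof.
move=> sA; exists ((fun s => x + s *: (y - x)) @` `[0, 1]%classic).
  split.
  - by exists 0; rewrite /= ?in_itv/= ?lexx ?ler01// scale0r addr0.
  - by move=> _ [s s01 <-]; apply: sA; rewrite /= in_itv in s01.
  - apply: connected_continuous_connected; first exact: segment_connected.
    apply: continuous_subspaceT => s.
    by apply: cvgD; [exact: cvg_cst|apply: cvgZr_tmp; exact: cvg_id].
by exists 1; rewrite /= ?in_itv/= ?lexx ?ler01// scale1r addrC subrK.
Qed.

(** Only the first exit of the ray matters for the infimum. Other boundary
    points may lie farther on the ray: in the disc model the ray can re-enter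
    the component after the first disc. *)
Lemma dist0_boundary A t s : 0 < s ->
  (forall r, 0 <= r < s -> nbhs (polar r t) A) ->
  (\forall r \near s^'+, ~ A (polar r t)) ->
  dist0 (half_line t `&` boundary A) = s.
Proof.
move=> s0 inA outA.
have clA : closure A (polar s t).
  move=> B Bs; have nearB : \forall r \near s^'-, B (polar r t).
    exact: cvg_at_left_filter (@continuous_ray t s) _ Bs.
  near s^'- => r; exists (polar r t); split; last by near: r.
  apply: nbhs_singleton; apply: inA; apply/andP; split.
    by near: r; exact: nbhs_left_ge.
  by near: r; exact: nbhs_left_lt.
have nintA : ~ nbhs (polar s t) A.
  move=> /(cvg_at_right_filter (@continuous_ray t s)) nearA.
  near s^'+ => r; have : A (polar r t) by near: r.
  by near: r.
have mem : [set enorm x | x in half_line t `&` boundary A] s.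
  exists (polar s t); last by rewrite enorm_polar gtr0_norm.
  by split; [exists s|split].
have lb : lbound [set enorm x | x in half_line t `&` boundary A] s.
  move=> _ [_ [[r /= r0 <-] [_ nA]] <-].
  rewrite enorm_polar gtr0_norm// leNgt; apply/negP => rs.
  by apply: nA; apply: inA; rewrite (ltW r0).
apply/eqP; rewrite eq_le /dist0; apply/andP; split.
- by apply: ge_inf => //; exists s.
- by apply: lb_le_inf => //; exists s.
Unshelve. all: by end_near. Qed.

End plane.

(** * Configurations of marks and the Crofton cell *)
Lemma near_finite_set (I : choiceType) (U : Type) (F : set_system U)
    (FF : Filter F) (A : set I) (P : I -> U -> Prop) : finite_set A ->
  (forall i, A i -> \forall y \near F, P i y) ->
  \forall y \near F, forall i, A i -> P i y.
Proof.
move=> finA PA.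
have : F (\bigcap_(i in [set` fset_set A]) P i).
  by apply: filter_bigI => i; rewrite in_fset_set// => /set_mem; exact: PA.
apply: filterS => y Py i Ai; apply: Py.
by rewrite /= in_fset_set//; exact: mem_set.
Qed.

Lemma finite_set_argmin (I : choiceType) (R : realType) (A : set I)
    (f : I -> R) (a : I) : finite_set A -> A a ->
  exists2 m, A m & forall i, A i -> f m <= f i.
Proof.
move=> /finite_seqP[s ->] /=.
elim: s a => [//|b s ih] a _.
case: s ih => [_|c s ih].
  by exists b => [|i]; rewrite /= inE// => /eqP ->.
have [m ms mP] := ih c (mem_head _ _).
have [bm|mb] := leP (f b) (f m).
- exists b => [|i] /=; first by rewrite mem_head.
  rewrite in_cons => /predU1P[->//|/mP]; exact: le_trans.
- exists m => [|i] /=; first by rewrite in_cons ms orbT.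
  by rewrite in_cons => /predU1P[->|/mP//]; exact: ltW.
Qed.

Section configuration.
Context {R : realType}.
Implicit Types (C : set (R * R * R)) (z : R * R * R) (t s : R) (x y : R * R).

(** For the sup norm, some mark makes with [x] an angle bounded away from the
    right angle; finitely many marks serve all [x], whence the bound [m]. *)
Definition spread C := exists m : R, forall x, exists z,
  [/\ C z, z.1.1 <= m & 2 / 5 * `|x| <= dircoord z.1.2 x].

Record regular (Rmin : R) C : Prop := Regular {
  reg_rho : forall z, C z -> 0 < z.1.1 ;
  reg_radius : forall z, C z -> Rmin < z.2 ;
  reg_finite : forall M : R, finite_set [set z | C z /\ z.1.1 <= M] ;
  reg_spread : spread C }.

(** The distance from 0 at which the ray of direction [t] meets the line of
    [z], when the cosine is positive. *)
Definition hit t z : R := z.1.1 / cos (z.1.2 - t).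

Definition generic_direction C t := forall z z', C z -> C z' ->
  0 < cos (z.1.2 - t) -> 0 < cos (z'.1.2 - t) -> hit t z = hit t z' -> z = z'.

(** The way local finiteness is used: an eventual property of each mark is
    eventual for all the marks simultaneously as soon as it is so for the
    marks with large [rho]. The filter is either the neighbourhoods of a point
    of the plane or [lambda --> +oo]. *)
Lemma near_all_marks (U : Type) (F : set_system U) (FF : Filter F) C
    (P : R * R * R -> U -> Prop) (M : R) :
  (forall M : R, finite_set [set z | C z /\ z.1.1 <= M]) ->
  (forall z, C z -> \forall y \near F, P z y) ->
  (\forall y \near F, forall z, C z -> M < z.1.1 -> P z y) ->
  \forall y \near F, forall z, C z -> P z y.
Proof.
move=> finC nearP farP.
have := near_finite_set FF (finC M) (fun z Hz => nearP z Hz.1).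
apply: filterS2 farP => y far close z Cz.
have [zM|Mz] := leP z.1.1 M; [exact: close|exact: far].
Qed.

(** The open intersection [U] of the half-planes is star-shaped about 0, hence
    inside the component; the component cannot cross a line. A point [x] of the
    closed intersection is the limit of the points [s *: x] of [U], s < 1. *)
Lemma crofton_cellE C : (forall z, C z -> 0 < z.1.1) ->
  crofton_cell C = [set x | forall z, C z -> dircoord z.1.2 x <= z.1.1].
Proof.
move=> rho0.
pose U := [set x : R * R | forall z, C z -> dircoord z.1.2 x < z.1.1].
have -> : crofton_cell C = closure U.
  congr closure; apply/seteqP; split => [x Cx z Cz|x Ux].
    have cK := @component_connected _
      (~` \bigcup_(z in C) line z.1.1 z.1.2) (0 : R * R).
    apply: (@connected_below R _ _ (dircoord z.1.2) 0 z.1.1 cK) => //.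
    - exact: continuous_dircoord.
    - by apply: connected_component_refl => -[z' Cz']; rewrite /line /=
        !mul0r addr0 => /esym/eqP; rewrite gt_eqF// rho0.
    - by rewrite dircoord0 rho0.
    - move=> y /connected_component_sub Cy; apply/eqP => yz.
      by apply: Cy; exists z.
  apply: segment_in_component => s /andP[s0 s1] [z Cz].
  rewrite subr0 add0r /line /= => /eqP; apply/negP.
  rewrite -/(dircoord _ (s *: x)) dircoordZ lt_eqF//.
  have [d0|d0] := leP (dircoord z.1.2 x) 0.
    by rewrite (le_lt_trans _ (rho0 _ Cz))// mulr_ge0_le0.
  by rewrite (le_lt_trans _ (Ux _ Cz))// ler_piMl// ltW.
apply/seteqP; split => [x Ux z Cz|x Kx].
  rewrite leNgt; apply/negP => xz.
  have [y [Uy]] := Ux _ (continuous_dircoord (lt_nbhsr xz)).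
  by rewrite /= ltNge ltW// Uy.
move=> B Bx.
have nearB : \forall s \near (1 : R)^'-, B (s *: x).
  have cx : (fun s : R => s *: x) @ (1 : R) --> x.
    by rewrite -[in X in _ --> X](scale1r x); apply: cvgZr_tmp; exact: cvg_id.
  exact: cvg_at_left_filter cx _ Bx.
near (1 : R)^'- => s.
have s0 : 0 <= s by near: s; exact: nbhs_left_ge.
have s1 : s < 1 by near: s; exact: nbhs_left_lt.
exists (s *: x); split; last by near: s.
move=> z Cz; rewrite dircoordZ.
by rewrite (le_lt_trans (ler_wpM2l s0 (Kx _ Cz)))// gtr_pMl// rho0.
Unshelve. all: by end_near. Qed.

Definition first_hit C t z := [/\ C z, 0 < cos (z.1.2 - t) &
  forall z', C z' -> z' != z -> 0 < cos (z'.1.2 - t) -> hit t z < hit t z'].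

(** As the cosine is at most 1, a line hit before a given distance has [rho]
    below this distance, so the minimum is over a finite set. *)
Lemma exists_first_hit Rmin C t : regular Rmin C -> generic_direction C t ->
  exists z, first_hit C t z.
Proof.
move=> [rho0 _ finC [m spreadC]] gen.
have [a [Ca _ ha]] := spreadC (polar 1 t).
have ca : 0 < cos (a.1.2 - t).
  rewrite dircoord_polar mul1r in ha; apply: lt_le_trans ha.
  rewrite mulr_gt0// normr_gt0; apply/eqP => p0.
  have := @enorm_polar R 1 t.
  rewrite p0 /enorm /= expr0n addr0 sqrtr0 normr1 => /esym/eqP.
  by rewrite oner_eq0.
pose A := [set z | C z /\ z.1.1 <= hit t a] `&` [set z | 0 < cos (z.1.2 - t)].
have hitE z : 0 < cos (z.1.2 - t) -> C z -> z.1.1 <= hit t z.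
  by move=> cz Cz; rewrite ler_pdivlMr// ler_piMr ?cos_le1// ltW ?rho0.
have finA : finite_set A by apply: finite_setIl; exact: finC.
have [|z [[Cz _] cz] zmin] := @finite_set_argmin _ R A (hit t) a finA.
  by split=> //; split => //; exact: hitE.
exists z; split => // z' Cz' z'z cz'.
rewrite lt_neqAle; apply/andP; split.
  by apply: contraNneq z'z => /(gen _ _ Cz Cz' cz cz') ->.
have [z'a|az'] := leP z'.1.1 (hit t a); first exact: zmin.
have : hit t z <= hit t a.
  by apply: zmin; split=> //; split => //; exact: hitE.
by move=> /le_trans; apply; rewrite (le_trans (ltW az'))// hitE.
Qed.

Lemma hit_gt0 t z : 0 < z.1.1 -> 0 < cos (z.1.2 - t) -> 0 < hit t z.
Proof. exact: divr_gt0. Qed.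

Lemma hit_cos t z : 0 < cos (z.1.2 - t) -> hit t z * cos (z.1.2 - t) = z.1.1.
Proof. by move=> c0; rewrite divfK// gt_eqF. Qed.

Lemma before_first_hit C t z z' s : (forall z, C z -> 0 < z.1.1) ->
  first_hit C t z -> C z' -> z' != z -> 0 <= s <= hit t z ->
  dircoord z'.1.2 (polar s t) < z'.1.1.
Proof.
move=> rho0 [Cz cz zmin] Cz' z'z /andP[s0 sz]; rewrite dircoord_polar.
have [c0|c0] := leP (cos (z'.1.2 - t)) 0.
  by rewrite (le_lt_trans _ (rho0 _ Cz'))// mulr_ge0_le0.
by rewrite -ltr_pdivlMr// (le_lt_trans sz)// zmin.
Qed.

Lemma near_half_planes C x :
  (forall M : R, finite_set [set z | C z /\ z.1.1 <= M]) ->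
  (forall z, C z -> dircoord z.1.2 x < z.1.1) ->
  \forall y \near x, forall z, C z -> dircoord z.1.2 y < z.1.1.
Proof.
move=> finC Cx; apply: (@near_all_marks _ (nbhs x) _ C
  (fun z y => dircoord z.1.2 y < z.1.1) (2 * (`|x| + 1)) finC) => [z Cz|].
  exact: continuous_dircoord (lt_nbhsl (Cx _ Cz)).
have : \forall y \near x, `|y| < `|x| + 1.
  have lt1 : `|x| < `|x| + 1 by rewrite ltrDl.
  exact: (@norm_continuous _ _ x _ (lt_nbhsl lt1)).
apply: filterS => y yx z Cz; apply: le_lt_trans.
rewrite (le_trans (ler_norm _))// (le_trans (dircoord_norm_le _ _))//.
by rewrite ler_wpM2l// ltW.
Qed.

Lemma dist0_crofton Rmin C t z : regular Rmin C -> first_hit C t z ->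
  dist0 (half_line t `&` boundary (crofton_cell C)) = hit t z.
Proof.
move=> [rho0 _ finC _] fz; have [Cz cz _] := fz.
have hz := hit_gt0 (rho0 _ Cz) cz.
rewrite crofton_cellE//; apply: dist0_boundary => // [s /andP[s0 sz]|].
  have : \forall y \near polar s t, forall z, C z -> dircoord z.1.2 y < z.1.1.
    apply: near_half_planes => // z' Cz'.
    have [->|z'z] := eqVneq z' z; first by rewrite dircoord_polar -ltr_pdivlMr.
    by apply: (before_first_hit rho0 fz) => //; rewrite s0 ltW.
  by apply: filterS => y yC z' Cz'; rewrite ltW// yC.
near=> s => /(_ _ Cz); rewrite dircoord_polar -ler_pdivlMr//; apply/negP.
by rewrite -ltNge; near: s; exact: nbhs_right_gt.
Unshelve. all: by end_near. Qed.

(** The other lines pass at a positive distance from the hitting point, so the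
    line hit first contains a small segment of the cell around this point. A
    line hit strictly later is met by the ray outside the cell. *)
Lemma edge_mark_first_hit Rmin C t z : regular Rmin C -> first_hit C t z ->
  edge_mark C t = z.
Proof.
move=> [rho0 _ finC _] fz; have [Cz cz zmin] := fz.
have hz := hit_gt0 (rho0 _ Cz) cz.
pose K := [set x : R * R | forall z, C z -> dircoord z.1.2 x <= z.1.1].
have KE : crofton_cell C = K by exact: crofton_cellE.
have Khit : K (polar (hit t z) t).
  move=> z' Cz'; have [->|z'z] := eqVneq z' z.
    by rewrite dircoord_polar hit_cos.
  by rewrite ltW// (before_first_hit rho0 fz)// lexx ltW.
have line_hit : line z.1.1 z.1.2 (polar (hit t z) t).
  by rewrite /line /= -/(dircoord _ (polar _ _)) dircoord_polar hit_cos.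
apply: xget_unique => [|z' [Cz' [_ _ [x [[xz' Kx]]]]]].
  split => //; split.
  - by rewrite KE => x /(_ _ Cz).
  - pose v : R * R := (- sin z.1.2, cos z.1.2).
    have dv : dircoord z.1.2 v = 0 by rewrite /dircoord /v /=; ring.
    have v0 : v != 0.
      apply/eqP => -[/eqP + c0]; rewrite oppr_eq0 => /eqP s0.
      by have := @cos2Dsin2 R z.1.2; rewrite c0 s0 expr0n addr0 => /esym/eqP;
        rewrite oner_eq0.
    have : \forall y \near polar (hit t z) t,
        forall z', (C `\ z) z' -> dircoord z'.1.2 y < z'.1.1.
      apply: near_half_planes => [M|z' [Cz' /eqP z'z]].
        by apply: sub_finite_set (finC M) => z' [[]].
      by rewrite (before_first_hit rho0 fz)// lexx ltW.
    have cvg_v : (fun e : R => polar (hit t z) t + e *: v) @ (0 : R) -->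
        polar (hit t z) t.
      rewrite -[in X in _ --> X](addr0 (polar _ _)).
      rewrite -[in X in _ --> X](scale0r v).
      by apply: cvgD; [exact: cvg_cst|apply: cvgZr_tmp; exact: cvg_id].
    move=> /cvg_v /(cvg_at_right_filter (f := id) cvg_id).
    move=> nearK; near (0 : R)^'+ => e.
    have e0 : 0 < e by near: e; exact: nbhs_right_gt.
    have Ke : forall z', (C `\ z) z' ->
      dircoord z'.1.2 (polar (hit t z) t + e *: v) < z'.1.1 by near: e.
    have De : dircoord z.1.2 (polar (hit t z) t + e *: v) = z.1.1.
      by rewrite dircoordD dircoordZ dv mulr0 addr0 dircoord_polar hit_cos.
    exists (polar (hit t z) t), (polar (hit t z) t + e *: v); split.
    + by rewrite -subr_eq0 opprD addNKr oppr_eq0 scaler_eq0 gt_eqF.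
    + by rewrite KE; split.
    + rewrite KE; split => // z' Cz'.
      have [->|z'z] := eqVneq z' z; first by rewrite De.
      by rewrite ltW// Ke//; split => //; exact/eqP.
  - exists (polar (hit t z) t); split; last by exists (hit t z).
    by rewrite KE; split.
move=> [s /= s0 sx]; move: xz' Kx; rewrite KE -sx.
rewrite /line/= -/(dircoord _ (polar _ _)) dircoord_polar => sz' Ks.
have cz' : 0 < cos (z'.1.2 - t) by rewrite -(pmulr_rgt0 _ s0) sz' rho0.
apply/esym/eqP/negPn/negP => z'z.
have := zmin _ Cz' _ cz'; rewrite eq_sym z'z => /(_ isT).
apply/negP; rewrite -leNgt /hit -sz' mulfK ?gt_eqF// ler_pdivlMr//.
by rewrite -dircoord_polar; exact: Ks.
Unshelve. all: by end_near. Qed.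

(** * The scaled disc model *)

(** The equation of the disc of [z] in the plane scaled by [lambda ^ 2],
    multiplied by [lambda ^ 2]. *)
Definition disc_form lambda z y : R :=
  (y.1 ^+ 2 + y.2 ^+ 2) / lambda ^+ 2 -
  2 * psi lambda z.1.1 z.2 * dircoord z.1.2 y + 2 * z.1.1 * z.2.

Definition scaled_component0 lambda C : set (R * R) :=
  [set lambda ^+ 2 *: x | x in component0 lambda C].

Lemma psi_ge0 (lambda rho r : R) : 0 < r -> 0 <= psi lambda rho r.
Proof. by move=> r0; rewrite mulr_ge0 ?sqrtr_ge0// ltW. Qed.

Lemma psi_sqr (lambda rho r : R) : 0 < lambda -> 0 <= rho -> 0 < r ->
  psi lambda rho r ^+ 2 = r ^+ 2 + 2 * rho * r / lambda ^+ 2.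
Proof.
move=> l0 rho0 r0; rewrite /psi exprMn sqr_sqrtr; last first.
  by rewrite addr_ge0// divr_ge0// mulr_ge0// ?sqr_ge0// ltW.
by field; rewrite !gt_eqF.
Qed.

Lemma psi_ge (lambda rho r : R) : 0 < lambda -> 0 <= rho -> 0 < r ->
  r <= psi lambda rho r.
Proof.
move=> l0 rho0 r0; rewrite -(@ler_pXn2r _ 2)// ?nnegrE ?psi_ge0 ?(ltW r0)//.
rewrite psi_sqr// lerDl divr_ge0 ?sqr_ge0// mulr_ge0 ?(ltW r0)//.
by rewrite mulr_ge0.
Qed.

Lemma disc_form_polar lambda z s t : disc_form lambda z (polar s t) =
  s ^+ 2 / lambda ^+ 2 - 2 * psi lambda z.1.1 z.2 * (s * cos (z.1.2 - t))
    + 2 * z.1.1 * z.2.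
Proof.
rewrite /disc_form dircoord_polar /polar /= !exprMn -mulrDr cos2Dsin2 mulr1//.
Qed.

Lemma sqrtr_lt (a r : R) : 0 < r -> (Num.sqrt a < r) = (a < r ^+ 2).
Proof.
by move=> r0; rewrite -{1}(gtr0_norm r0) -sqrtr_sqr ltr_sqrt ?exprn_gt0.
Qed.

Lemma scaled_disc lambda z y : 0 < lambda -> 0 <= z.1.1 -> 0 < z.2 ->
  disc lambda z.1.1 z.1.2 z.2 ((lambda ^+ 2)^-1 *: y) <->
  disc_form lambda z y < 0.
Proof.
move=> l0 rho0 r0; rewrite /disc /= /enorm.
rewrite sqrtr_lt// -subr_lt0.
have e0 : 0 < (lambda ^+ 2)^-1 by rewrite invr_gt0 exprn_gt0.
rewrite -[disc_form _ _ _ < 0](pmulr_rlt0 _ e0).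
set X := (X in X < 0 <-> _); set Y := (Y in _ <-> Y < 0).
suff -> : X = Y by [].
have h : 2 * z.1.1 * z.2 / lambda ^+ 2 = psi lambda z.1.1 z.2 ^+ 2 - z.2 ^+ 2.
  by rewrite psi_sqr// addrC addKr.
have -> : Y = (lambda ^+ 2)^-1 * ((y.1 ^+ 2 + y.2 ^+ 2) / lambda ^+ 2 -
    2 * psi lambda z.1.1 z.2 * dircoord z.1.2 y)
    + 2 * z.1.1 * z.2 / lambda ^+ 2.
  by rewrite /Y /disc_form; ring.
rewrite h /X /polar /dircoord /=.
set p := psi _ _ _; have := @cos2Dsin2 R z.1.2.
set c := cos _; set s := sin _ => cs.
have -> : p ^+ 2 = p ^+ 2 * (c ^+ 2 + s ^+ 2) by rewrite cs mulr1.
rewrite /GRing.scale /=.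
by field; rewrite gt_eqF.
Qed.

Lemma covered_scaled lambda C y : 0 < lambda -> (forall z, C z -> 0 < z.1.1) ->
  (forall z, C z -> 0 < z.2) ->
  covered lambda C ((lambda ^+ 2)^-1 *: y) <->
    exists2 z, C z & disc_form lambda z y < 0.
Proof.
move=> l0 rho0 r0; split=> -[z Cz] /scaled_disc; last first.
  by move=> h; exists z => //; apply: h => //; [exact/ltW/rho0|exact: r0].
by move=> h; exists z => //; apply: h => //; [exact/ltW/rho0|exact: r0].
Qed.

Lemma continuous_disc_form lambda z :
  continuous (disc_form lambda z : R * R -> R).
Proof.
move=> y; have c1 : (fun x : R * R => x.1 ^+ 2) @ y --> y.1 ^+ 2.
  by apply: (@continuous_comp _ _ _ fst (fun a : R => a ^+ 2));
    [exact: cvg_fst|exact: exprn_continuous].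
have c2 : (fun x : R * R => x.2 ^+ 2) @ y --> y.2 ^+ 2.
  by apply: (@continuous_comp _ _ _ snd (fun a : R => a ^+ 2));
    [exact: cvg_snd|exact: exprn_continuous].
apply: cvgD; last exact: cvg_cst.
apply: cvgB; last by apply: cvgMl_tmp; exact: continuous_dircoord.
by apply: cvgMr_tmp; exact: cvgD c1 c2.
Qed.

(** For lambda >= 1, psi^2 <= r^2 + 2 rho r, so the linear term, at most
    4 psi B, is dominated by 2 rho r once rho^2 > 4 B^2 (1 + 2 rho / Rmin); the
    bound on rho below implies this. *)
Lemma disc_form_far (Rmin B : R) lambda z y : 0 < Rmin -> 0 <= B ->
  1 <= lambda -> Rmin < z.2 -> `|y| <= B -> 8 * B ^+ 2 / Rmin + 2 * B < z.1.1 ->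
  0 < disc_form lambda z y.
Proof.
move=> Rmin0 B0 l1 Rr yB far; rewrite /disc_form.
set p := psi _ _ _; set rho := z.1.1 in far p *; set r := z.2 in Rr p *.
have r0 := lt_trans Rmin0 Rr.
have l0 : 0 < lambda by rewrite (lt_le_trans ltr01).
have a0 : 0 <= 8 * B ^+ 2 / Rmin.
  by rewrite divr_ge0 ?(ltW Rmin0)// mulr_ge0// sqr_ge0.
have rho0 : 0 < rho by lra.
have p0 : 0 <= p by exact: psi_ge0.
have dB : dircoord z.1.2 y <= 2 * B.
  rewrite (le_trans (ler_norm _))// (le_trans (dircoord_norm_le _ _))//.
  by rewrite ler_wpM2l.
have pp : p ^+ 2 <= r ^+ 2 + 2 * rho * r.
  rewrite psi_sqr ?(ltW rho0)// lerD2l ler_piMr//.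
    by rewrite mulr_ge0 ?(ltW r0)// mulr_ge0// ltW.
  by rewrite invf_le1 ?exprn_gt0// exprn_ege1.
have key : p * (2 * B) < rho * r.
  rewrite -(@ltr_pXn2r _ 2)// ?nnegrE; last 2 first.
  - by rewrite mulr_ge0// mulr_ge0.
  - by rewrite mulr_ge0// ltW.
  have h1 : 8 * B ^+ 2 * rho <= Rmin * (8 * B ^+ 2 / Rmin * rho).
    by rewrite mulrA [Rmin * _]mulrC divfK ?gt_eqF.
  have h2 : 8 * B ^+ 2 / Rmin * rho < rho ^+ 2 - 4 * B ^+ 2.
    by nra.
  have h3 : 8 * B ^+ 2 * rho < r * (rho ^+ 2 - 4 * B ^+ 2).
    rewrite (le_lt_trans h1)//.
    rewrite (lt_trans (y := Rmin * (rho ^+ 2 - 4 * B ^+ 2)))//.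
      by rewrite ltr_pM2l.
    rewrite ltr_pM2r// (le_lt_trans _ h2)// mulr_ge0// ltW//.
  rewrite exprMn.
  apply: (@le_lt_trans _ _ ((r ^+ 2 + 2 * rho * r) * (2 * B) ^+ 2)).
    by rewrite ler_wpM2r ?sqr_ge0.
  rewrite -subr_gt0 (_ : _ - _ =
      r * (r * (rho ^+ 2 - 4 * B ^+ 2) - 8 * B ^+ 2 * rho)).
    by rewrite mulr_gt0// subr_gt0.
  by ring.
have y2 : 0 <= (y.1 ^+ 2 + y.2 ^+ 2) / lambda ^+ 2.
  by rewrite divr_ge0 ?addr_ge0 ?sqr_ge0.
have : p * dircoord z.1.2 y <= p * (2 * B) by rewrite ler_wpM2l.
lra.
Qed.

Lemma near_disc_form (Rmin lambda : R) C x : 0 < Rmin -> 1 <= lambda ->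
  regular Rmin C -> (forall z, C z -> 0 < disc_form lambda z x) ->
  \forall y \near x, forall z, C z -> 0 < disc_form lambda z y.
Proof.
move=> Rmin0 l1 [_ rC finC _] Cx; pose B := `|x| + 1.
apply: (@near_all_marks _ (nbhs x) _ C (fun z y => 0 < disc_form lambda z y)
  (8 * B ^+ 2 / Rmin + 2 * B) finC) => [z Cz|].
  exact: continuous_disc_form (lt_nbhsr (Cx _ Cz)).
have : \forall y \near x, `|y| < `|x| + 1.
  have lt1 : `|x| < `|x| + 1 by rewrite ltrDl.
  exact: (@norm_continuous _ _ x _ (lt_nbhsl lt1)).
apply: filterS => y yx z Cz zB.
apply: (disc_form_far Rmin0 _ l1 (rC _ Cz) (ltW yx) zB).
by rewrite addr_ge0.
Qed.

Lemma scaled_component0P lambda C y : 0 < lambda ->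
  scaled_component0 lambda C y <-> component0 lambda C ((lambda ^+ 2)^-1 *: y).
Proof.
move=> l0; have l2 : lambda ^+ 2 != 0 by rewrite gt_eqF ?exprn_gt0.
split=> [[x Dx <-]|Dy]; first by rewrite scalerA mulVf// scale1r.
by exists ((lambda ^+ 2)^-1 *: y) => //; rewrite scalerA divff// scale1r.
Qed.

(** Each point of a small uncovered disc around the point of the ray is joined
    to 0 by a broken line: the segment of the ray, then a radius. *)
Lemma scaled_component0_interior (Rmin lambda : R) C s t : 0 < Rmin ->
  1 <= lambda -> regular Rmin C ->
  (forall u z, 0 <= u <= 1 -> C z ->
    0 < disc_form lambda z (polar (u * s) t)) ->
  nbhs (polar s t) (scaled_component0 lambda C).
Proof.
move=> Rmin0 l1 regC free; have [rho0 rC _ _] := regC.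
have r0 z : C z -> 0 < z.2 by move=> /rC; exact: lt_trans.
have l0 : 0 < lambda by rewrite (lt_le_trans ltr01).
have unc y : (forall z, C z -> 0 < disc_form lambda z y) ->
    (~` covered lambda C) ((lambda ^+ 2)^-1 *: y).
  move=> yC /(covered_scaled _ l0 rho0 r0)[z Cz].
  by apply/negP; rewrite -leNgt ltW// yC.
have Ds : component0 lambda C ((lambda ^+ 2)^-1 *: polar s t).
  apply: segment_in_component => u u01.
  rewrite add0r subr0 scalerA mulrC -scalerA polarZ; apply: unc => z Cz.
  exact: free.
have /nbhs_ballP[e /= e0 eC] : \forall y \near polar s t,
    forall z, C z -> 0 < disc_form lambda z y.
  apply: (near_disc_form Rmin0 l1 regC) => z Cz.
  by rewrite -[s]mul1r; apply: free; rewrite // ler01 lexx.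
apply/nbhs_ballP; exists e => //= y; rewrite -ball_normE /= => ey.
apply/scaled_component0P => //; apply: connected_component_trans Ds _.
apply: segment_in_component => u /andP[u0 u1].
rewrite -scalerBr scalerA mulrC -scalerA -scalerDr; apply: unc.
apply: eC; rewrite -ball_normE /= opprD addrA subrr sub0r normrN normrZ.
rewrite ger0_norm//.
by rewrite (le_lt_trans _ ey)// -normrN opprB ler_piMl.
Qed.

End configuration.

(** * Asymptotics of the first intersection of the ray with one disc *)
Section asymptotics.
Context {R : realType}.
Implicit Types (C : set (R * R * R)) (z : R * R * R) (t s lambda rho r : R).

Lemma cvg_inv_sqr : (fun lambda : R => (lambda ^+ 2)^-1) @ +oo --> (0 : R).
Proof.
apply/gtr0_cvgV0; last exact: cvgr_expr2.
by near=> l; rewrite exprn_gt0//; near: l; exact: nbhs_pinfty_gt.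
Unshelve. all: by end_near. Qed.

Lemma cvg_sqrt (T : Type) (F : set_system T) {FF : Filter F}
    (f : T -> R) (l : R) :
  f @ F --> l -> (fun x => Num.sqrt (f x)) @ F --> Num.sqrt l.
Proof. by move=> fl; exact: cvg_comp fl (@sqrt_continuous R l). Qed.

Lemma cvg_psi rho r : 0 < r -> (fun lambda => psi lambda rho r) @ +oo --> r.
Proof.
move=> r0; rewrite /psi.
have -> : (fun lambda => r * Num.sqrt (1 + 2 * rho / (lambda ^+ 2 * r))) =
    (fun lambda => r * Num.sqrt (1 + 2 * rho / r * (lambda ^+ 2)^-1)).
  by apply/funext => l; rewrite invfM; congr (_ * Num.sqrt (_ + _)); ring.
rewrite [X in _ --> X](_ : r = r * Num.sqrt (1 + 2 * rho / r * 0)); last first.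
  by rewrite mulr0 addr0 sqrtr1 mulr1.
apply: cvgMl_tmp; apply: cvg_sqrt.
by apply: cvgD; [exact: cvg_cst|apply: cvgMl_tmp; exact: cvg_inv_sqr].
Qed.

(** The smaller root of the quadratic equation of [disc_form_polar], in the
    form that has a limit when the leading coefficient tends to 0. *)
Definition disc_hit t lambda z : R :=
  let pc := psi lambda z.1.1 z.2 * cos (z.1.2 - t) in
  2 * z.1.1 * z.2 /
  (pc + Num.sqrt (pc ^+ 2 - 2 * z.1.1 * z.2 * (lambda ^+ 2)^-1)).

Lemma cvg_disc_hit t z : 0 < z.2 -> 0 < cos (z.1.2 - t) ->
  disc_hit t lambda z @[lambda --> +oo] --> hit t z.
Proof.
move=> r0 c0; set c := cos _ in c0 *.
have rc0 : 0 < z.2 * c by rewrite mulr_gt0.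
have -> : hit t z = 2 * z.1.1 * z.2 * (z.2 * c +
    Num.sqrt ((z.2 * c) ^+ 2 - 2 * z.1.1 * z.2 * 0))^-1.
  rewrite mulr0 subr0 sqrtr_sqr gtr0_norm// /hit -/c.
  by field; rewrite !gt_eqF// addr_gt0.
have cp : (fun lambda => psi lambda z.1.1 z.2 * c) @ +oo --> z.2 * c.
  by apply: cvgMr_tmp; exact: cvg_psi.
rewrite /disc_hit -/c; apply: cvgMl_tmp; apply: cvgV.
  by rewrite gt_eqF// ltr_wpDr// sqrtr_ge0.
apply: cvgD => //; apply: cvg_sqrt.
apply: cvgB; last by apply: cvgMl_tmp; exact: cvg_inv_sqr.
rewrite expr2; under eq_fun do rewrite expr2; exact: cvgM.
Qed.

Lemma disc_hit_root t z : 0 <= z.1.1 -> 0 < z.2 -> 0 < cos (z.1.2 - t) ->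
  \forall lambda \near +oo,
    disc_form lambda z (polar (disc_hit t lambda z) t) = 0.
Proof.
move=> rho0 r0 c0.
have near_disc : \forall lambda \near +oo,
    2 * z.1.1 * z.2 * (lambda ^+ 2)^-1 < (z.2 * cos (z.1.2 - t)) ^+ 2.
  have : (fun l => 2 * z.1.1 * z.2 * (l ^+ 2)^-1) @ +oo --> 2 * z.1.1 * z.2 * 0.
    by apply: cvgMl_tmp; exact: cvg_inv_sqr.
  by move/cvgr_lt; apply; rewrite mulr0 exprn_gt0// mulr_gt0.
near=> l.
have l0 : 0 < l by near: l; exact: nbhs_pinfty_gt.
have h : 2 * z.1.1 * z.2 * (l ^+ 2)^-1 < (z.2 * cos (z.1.2 - t)) ^+ 2.
  by near: l.
rewrite disc_form_polar /disc_hit.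
set c := cos _ in c0 h *; set p := psi _ _ _.
have rp : z.2 <= p by exact: psi_ge.
have p0 : 0 < p by rewrite (lt_le_trans r0).
set D := (p * c) ^+ 2 - 2 * z.1.1 * z.2 * (l ^+ 2)^-1.
have D0 : 0 <= D.
  rewrite /D subr_ge0 (le_trans (ltW h))//.
  have zc0 : 0 <= z.2 * c by rewrite mulr_ge0// ltW.
  have pc0 : 0 <= p * c by rewrite mulr_ge0// ltW.
  by apply: lerXn2r => //; rewrite ler_wpM2r// ltW.
have /eqP := sqr_sqrtr D0; set q := Num.sqrt D => /eqP qD.
have w0 : 0 < p * c + q by rewrite ltr_wpDr ?sqrtr_ge0// mulr_gt0.
transitivity (2 * z.1.1 * z.2 / (p * c + q) ^+ 2 *
   (2 * z.1.1 * z.2 * (l ^+ 2)^-1 - (p * c) ^+ 2 + q ^+ 2)).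
  by field; rewrite !gt_eqF.
by rewrite qD /D; ring.
Unshelve. all: by end_near. Qed.

(** Replacing 2 rho r by 2 r c L in the quadratic equation of the root s
    expresses the gap, times lambda^2, as the continuous function [g] of s and
    psi, whose limits are L and r. *)
Lemma cvg_scaled_gap t z : 0 <= z.1.1 -> 0 < z.2 -> 0 < cos (z.1.2 - t) ->
  lambda ^+ 2 * (disc_hit t lambda z - hit t z) @[lambda --> +oo] -->
  - (hit t z ^+ 2 / 2) * (cos (2 * (z.1.2 - t)) / (z.2 * cos (z.1.2 - t))).
Proof.
move=> rho0 r0 c0; set c := cos (z.1.2 - t) in c0 *.
pose g lambda := (disc_hit t lambda z ^+ 2 - 4 * c * z.1.1 * z.2 *
  (disc_hit t lambda z * (psi lambda z.1.1 z.2 + z.2)^-1)) * (2 * z.2 * c)^-1.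
suff cvg_g : g @ +oo --> - (hit t z ^+ 2 / 2) *
    (cos (2 * (z.1.2 - t)) / (z.2 * c)).
  apply: cvg_trans cvg_g; apply: near_eq_cvg; rewrite /g.
  near=> l.
  have l0 : 0 < l by near: l; exact: nbhs_pinfty_gt.
  have : disc_form l z (polar (disc_hit t l z) t) = 0.
    by near: l; exact: disc_hit_root.
  rewrite disc_form_polar -/c; set s := disc_hit _ _ _; set p := psi _ _ _.
  have rp : z.2 <= p by exact: psi_ge.
  have p0 : 0 < p by rewrite (lt_le_trans r0).
  have pE : p ^+ 2 = z.2 ^+ 2 + 2 * z.1.1 * z.2 / l ^+ 2 by exact: psi_sqr.
  move: pE; set a := l ^+ 2 => pE sE.
  have a0 : 0 < a by rewrite exprn_gt0.
  have s2 : s ^+ 2 = a * (2 * p * (s * c) - 2 * z.1.1 * z.2).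
    have <- : s ^+ 2 / a = 2 * p * (s * c) - 2 * z.1.1 * z.2.
      by rewrite -[RHS]addr0 -sE; ring.
    by rewrite mulrC divfK// gt_eqF.
  have ap : a * (p ^+ 2 - z.2 ^+ 2) = 2 * z.1.1 * z.2.
    by rewrite pE; field; rewrite gt_eqF.
  (* the gap and [g] are compared after clearing their denominators *)
  rewrite /hit -/c; apply/esym.
  apply: (mulIf (x := 2 * z.2 * c * (p + z.2))).
    by rewrite !mulf_neq0 ?gt_eqF// addr_gt0.
  rewrite [RHS](_ : _ =
      s ^+ 2 * (p + z.2) - 4 * c * z.1.1 * z.2 * s); last first.
    by field; rewrite !gt_eqF// addr_gt0.
  rewrite [LHS](_ : _ =
      a * (2 * z.2 * c * s - 2 * z.2 * z.1.1) * (p + z.2)); last first.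
    by field; rewrite gt_eqF.
  have -> : 4 * c * z.1.1 * z.2 * s = 2 * c * s * (a * (p ^+ 2 - z.2 ^+ 2)).
    by rewrite ap; ring.
  by rewrite s2; ring.
have -> : - (hit t z ^+ 2 / 2) * (cos (2 * (z.1.2 - t)) / (z.2 * c)) =
    (hit t z ^+ 2 - 4 * c * z.1.1 * z.2 * (hit t z * (z.2 + z.2)^-1))
      * (2 * z.2 * c)^-1.
  rewrite mulr_natl cos_mulr2n -/c /hit -/c.
  by field; rewrite !gt_eqF// addr_gt0.
have cs := cvg_disc_hit r0 c0; rewrite /g.
apply: cvgMr_tmp; apply: cvgB.
  rewrite expr2; under eq_fun do rewrite expr2; exact: cvgM.
apply: cvgMl_tmp; apply: cvgM => //; apply: cvgV.
  by rewrite gt_eqF// addr_gt0.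
by apply: cvgD; [exact: cvg_psi|exact: cvg_cst].
Unshelve. all: by end_near. Qed.

End asymptotics.

(** * Convergence of the defect for a regular configuration *)
Section deterministic.
Context {R : realType}.
Implicit Types (C : set (R * R * R)) (z : R * R * R) (t s lambda rho r : R).

Lemma polar_norm_le s t : `|polar s t : R * R| <= `|s|.
Proof.
by rewrite prod_normE /= ge_max !normrM !ler_piMr ?cos_max ?sin_max.
Qed.

(** For a mark with c > 0, the form at distance s is at least
    2 (rho r - psi c s), and the limit of psi c s at the root is r c L, which is
    smaller than rho r as the line is hit after L. *)
Lemma near_free_others Rmin C t z : 0 < Rmin -> regular Rmin C ->
  first_hit C t z -> \forall lambda \near +oo, forall z', (C `\ z) z' ->
  forall s, 0 <= s <= disc_hit t lambda z ->
    0 < disc_form lambda z' (polar s t).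
Proof.
move=> Rmin0 [rho0 rC finC _] [Cz cz zmin].
have r0 z' : C z' -> 0 < z'.2 by move=> /rC; exact: lt_trans.
have hz := hit_gt0 (rho0 _ Cz) cz.
have cvgz := cvg_disc_hit (r0 _ Cz) cz.
pose B := hit t z + 1.
apply: (@near_all_marks _ _ +oo _ (C `\ z) (fun z' lambda => forall s,
  0 <= s <= disc_hit t lambda z -> 0 < disc_form lambda z' (polar s t))
  (8 * B ^+ 2 / Rmin + 2 * B)) => [M|z' [Cz' /eqP z'z]|].
- by apply: sub_finite_set (finC M) => z' [[]].
- have rho'0 := rho0 _ Cz'; have r'0 := r0 _ Cz'.
  have rr0 : 0 < z'.1.1 * z'.2 by rewrite mulr_gt0.
  have [c0|c0] := leP (cos (z'.1.2 - t)) 0.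
    near=> l => s /andP[s0 _]; rewrite disc_form_polar.
    have p0 : 0 <= psi l z'.1.1 z'.2 by exact: psi_ge0.
    have : 0 <= s ^+ 2 / l ^+ 2 by rewrite divr_ge0 ?sqr_ge0.
    have : psi l z'.1.1 z'.2 * (s * cos (z'.1.2 - t)) <= 0.
      by rewrite mulr_ge0_le0// mulr_ge0_le0.
    lra.
  have : \forall l \near +oo, disc_hit t l z *
      (psi l z'.1.1 z'.2 * cos (z'.1.2 - t)) < z'.1.1 * z'.2.
    have lim : (fun l => disc_hit t l z *
        (psi l z'.1.1 z'.2 * cos (z'.1.2 - t))) @ +oo -->
        hit t z * (z'.2 * cos (z'.1.2 - t)).
      by apply: cvgM => //; apply: cvgMr_tmp; exact: cvg_psi.
    apply: (cvgr_lt _ lim).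
    by rewrite mulrCA mulrC ltr_pM2r// -ltr_pdivlMr// zmin.
  apply: filterS => l key s /andP[s0 sl]; rewrite disc_form_polar.
  have p0 : 0 <= psi l z'.1.1 z'.2 by exact: psi_ge0.
  have : 0 <= s ^+ 2 / l ^+ 2 by rewrite divr_ge0 ?sqr_ge0.
  have : s * (psi l z'.1.1 z'.2 * cos (z'.1.2 - t)) <=
    disc_hit t l z * (psi l z'.1.1 z'.2 * cos (z'.1.2 - t)).
    by rewrite ler_wpM2r// mulr_ge0// ltW.
  rewrite mulrCA; lra.
- near=> l => z' [Cz' _] farz' s /andP[s0 sl].
  apply: (disc_form_far Rmin0 _ _ (rC _ Cz') _ farz').
  + by rewrite addr_ge0// ltW.
  + by near: l; exact: nbhs_pinfty_ge.
  + rewrite (le_trans (polar_norm_le _ _))// ger0_norm// (le_trans sl)// ltW//.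
    by near: l; apply: (cvgr_lt _ cvgz); rewrite ltrDl.
Unshelve. all: by end_near. Qed.

(** Evaluated at a root s', this factors the form on the ray. *)
Lemma disc_form_increment lambda z s s' t :
  disc_form lambda z (polar s t) - disc_form lambda z (polar s' t) =
  (s' - s) * (2 * (psi lambda z.1.1 z.2 * cos (z.1.2 - t)) -
              (s' + s) * (lambda ^+ 2)^-1).
Proof. by rewrite !disc_form_polar; ring. Qed.

Lemma near_disc_hit_sign Rmin C t z : 0 < Rmin -> regular Rmin C -> C z ->
  0 < cos (z.1.2 - t) -> \forall lambda \near +oo,
    [/\ 0 < disc_hit t lambda z,
      forall s, s < disc_hit t lambda z -> 0 < disc_form lambda z (polar s t) &
      \forall s \near (disc_hit t lambda z)^'+,
        disc_form lambda z (polar s t) < 0].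
Proof.
move=> Rmin0 [rho0 rC _ _] Cz c0.
have r0 : 0 < z.2 by exact: lt_trans (rC _ Cz).
have rho := rho0 _ Cz; have hz := hit_gt0 rho c0.
have cvgz := cvg_disc_hit r0 c0.
have near_pos : \forall l \near +oo, 0 < disc_hit t l z.
  exact: cvgr_gt _ cvgz _ hz.
have near_small : \forall l \near +oo,
    disc_hit t l z * (l ^+ 2)^-1 < z.2 * cos (z.1.2 - t).
  have lim : (fun l => disc_hit t l z * (l ^+ 2)^-1) @ +oo --> hit t z * 0.
    by apply: cvgM => //; exact: cvg_inv_sqr.
  apply: (cvgr_lt _ lim).
  by rewrite mulr0 mulr_gt0.
near=> l.
have l0 : 0 < l by near: l; exact: nbhs_pinfty_gt.
have small : disc_hit t l z * (l ^+ 2)^-1 < z.2 * cos (z.1.2 - t) by near: l.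
have root : disc_form l z (polar (disc_hit t l z) t) = 0.
  by near: l; apply: disc_hit_root => //; exact: ltW.
have pr : z.2 * cos (z.1.2 - t) <= psi l z.1.1 z.2 * cos (z.1.2 - t).
  by rewrite ler_wpM2r ?(ltW c0)// psi_ge// ltW.
have e0 : 0 < (l ^+ 2)^-1 by rewrite invr_gt0 exprn_gt0.
have pos : 0 < disc_hit t l z by near: l.
set s1 := disc_hit t l z in small root pos *.
have formE s : disc_form l z (polar s t) = (s1 - s) *
    (2 * (psi l z.1.1 z.2 * cos (z.1.2 - t)) - (s1 + s) * (l ^+ 2)^-1).
  by rewrite -disc_form_increment root subr0.
split => //.
- move=> s ss1; rewrite formE mulr_gt0 ?subr_gt0//.
  have : s * (l ^+ 2)^-1 < s1 * (l ^+ 2)^-1 by rewrite ltr_pM2r.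
  lra.
- have : (fun s => (s1 + s) * (l ^+ 2)^-1) @ s1 --> (s1 + s1) * (l ^+ 2)^-1.
    by apply: cvgMr_tmp; apply: cvgD; [exact: cvg_cst|exact: cvg_id].
  move=> lim.
  have lt2 : (s1 + s1) * (l ^+ 2)^-1 < 2 * (psi l z.1.1 z.2 * cos (z.1.2 - t)).
    by rewrite mulrDl; lra.
  have near2 : \forall s \near s1^'+, (s1 + s) * (l ^+ 2)^-1 <
      2 * (psi l z.1.1 z.2 * cos (z.1.2 - t)).
    exact: cvgr_lt _ (cvg_at_right_filter lim) _ lt2.
  near=> s.
  rewrite formE nmulr_rlt0 ?subr_gt0 ?subr_lt0.
    by near: s.
  by near: s; exact: nbhs_right_gt.
Unshelve. all: by end_near. Qed.

(** On the square of sup norm M in the scaled plane, some mark has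
    <y, e_theta> >= 2 M / 5 = |m| + 1 with rho <= m, so its form is at most
    2 M^2 / lambda^2 - 2 r, negative for large lambda. *)
Lemma near_bounded_component0 Rmin C : 0 < Rmin -> regular Rmin C ->
  \forall lambda \near +oo, bounded_set (component0 lambda C).
Proof.
move=> Rmin0 [rho0 rC _ [m spreadC]]; pose M := 5 / 2 * (`|m| + 1).
have m0 : 0 <= `|m| by [].
have M0 : 0 < M by rewrite /M; lra.
have near_small : \forall l \near +oo, 2 * M ^+ 2 * (l ^+ 2)^-1 < 2 * Rmin.
  have lim : (fun l => 2 * M ^+ 2 * (l ^+ 2)^-1) @ +oo --> 2 * M ^+ 2 * 0.
    by apply: cvgMl_tmp; exact: cvg_inv_sqr.
  apply: (cvgr_lt _ lim).
  by rewrite mulr0 mulr_gt0.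
near=> l.
have l0 : 0 < l by near: l; exact: nbhs_pinfty_gt.
have small : 2 * M ^+ 2 * (l ^+ 2)^-1 < 2 * Rmin by near: l.
have e0 : 0 < (l ^+ 2)^-1 by rewrite invr_gt0 exprn_gt0.
have r0 z : C z -> 0 < z.2 by move=> /rC; exact: lt_trans.
have blocked (y : R * R) : `|y| = M -> covered l C ((l ^+ 2)^-1 *: y).
  move=> yM; apply/(covered_scaled _ l0 rho0 r0).
  have [z [Cz zm zy]] := spreadC y; exists z => //.
  have Rz := rC _ Cz.
  have pz : z.2 <= psi l z.1.1 z.2 by apply: psi_ge; rewrite ?r0// ltW ?rho0.
  have y2 : y.1 ^+ 2 + y.2 ^+ 2 <= 2 * M ^+ 2.
    have h (a : R) : `|a| <= `|y| -> a ^+ 2 <= M ^+ 2.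
      rewrite yM -[a ^+ 2]real_normK ?num_real// => aM.
      by apply: lerXn2r aM; rewrite nnegrE// ltW.
    have := h _ (fst_norm_le y); have := h _ (snd_norm_le y); lra.
  rewrite /disc_form.
  have : (y.1 ^+ 2 + y.2 ^+ 2) / l ^+ 2 <= 2 * M ^+ 2 * (l ^+ 2)^-1.
    by rewrite ler_wpM2r// ltW.
  have : z.2 * (`|m| + 1) <= psi l z.1.1 z.2 * dircoord z.1.2 y.
    have m1 : 0 <= `|m| + 1 by lra.
    apply: (ler_pM (ltW (r0 _ Cz)) m1 pz).
    by apply: le_trans zy; rewrite yM /M; lra.
  have : z.1.1 * z.2 <= `|m| * z.2.
    by rewrite ler_wpM2r ?(ltW (r0 _ Cz))// (le_trans zm)// ler_norm.
  lra.
have inball : forall x, component0 l C x -> `|x| < (l ^+ 2)^-1 * M.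
  have cK := @component_connected _ (~` covered l C) (0 : R * R).
  move=> x Dx.
  apply: (@connected_below R _ _ (fun y : R * R => `|y|) 0
    ((l ^+ 2)^-1 * M) cK) => //.
  - exact: norm_continuous.
  - apply: connected_component_refl.
    have : (~` covered l C) ((l ^+ 2)^-1 *: 0).
      move=> /(covered_scaled _ l0 rho0 r0)[z Cz].
      rewrite /disc_form dircoord0 /= expr0n addr0 mul0r mulr0 subr0 add0r.
      by apply/negP; rewrite -leNgt !mulr_ge0// ltW ?rho0 ?r0.
    by rewrite scaler0.
  - by rewrite normr0 mulr_gt0.
  - move=> y /connected_component_sub ny; apply/eqP => yM.
    have l2 : 0 < l ^+ 2 by rewrite exprn_gt0.
    apply: ny; rewrite (_ : y = (l ^+ 2)^-1 *: (l ^+ 2 *: y)); last first.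
      by rewrite scalerA mulVf ?scale1r// gt_eqF.
    by apply: blocked; rewrite normrZ yM gtr0_norm// mulVKf// gt_eqF.
exists ((l ^+ 2)^-1 * M); split; first exact: num_real.
by move=> N MN x /inball xM; exact: ltW (lt_trans xM MN).
Unshelve. all: by end_near. Qed.

Lemma near_dist0_scaled (K0 : set (R * R)) Rmin C t z : 0 < Rmin ->
  regular Rmin C -> first_hit C t z -> \forall lambda \near +oo,
  dist0 (half_line t `&` boundary (scaled_component K0 lambda C)) =
  disc_hit t lambda z.
Proof.
move=> Rmin0 regC fz; have [Cz cz zmin] := fz.
have [rho0 rC _ _] := regC.
have r0 z' : C z' -> 0 < z'.2 by move=> /rC; exact: lt_trans.
near=> l.
have l0 : 0 < l by near: l; exact: nbhs_pinfty_gt.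
have l1 : 1 <= l by near: l; exact: nbhs_pinfty_ge.
have -> : scaled_component K0 l C = scaled_component0 l C.
  rewrite /scaled_component asboolT//; near: l.
  exact: near_bounded_component0 regC.
have others : forall z', (C `\ z) z' -> forall s, 0 <= s <= disc_hit t l z ->
    0 < disc_form l z' (polar s t).
  by near: l; exact: near_free_others regC fz.
have [s10 before after] : [/\ 0 < disc_hit t l z,
      forall s, s < disc_hit t l z -> 0 < disc_form l z (polar s t) &
      \forall s \near (disc_hit t l z)^'+, disc_form l z (polar s t) < 0].
  by near: l; exact: near_disc_hit_sign regC Cz cz.
apply: dist0_boundary => // [s /andP[s0 ss1]|].
  apply: (scaled_component0_interior Rmin0 l1 regC) => u z' /andP[u0 u1] Cz'.
  have us : u * s <= s by rewrite ler_piMl.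
  have [->|z'z] := eqVneq z' z; first by rewrite before// (le_lt_trans us).
  apply: others; first by split => //; exact/eqP.
  by rewrite mulr_ge0//= (le_trans us)// ltW.
apply: filterS after => s form0 /(scaled_component0P _ _ l0).
move=> /connected_component_sub; apply.
by apply/(covered_scaled _ l0 rho0 r0); exists z.
Unshelve. all: by end_near. Qed.

Theorem cvg_defect (K0 : set (R * R)) Rmin C t : 0 < Rmin -> regular Rmin C ->
  generic_direction C t ->
  lambda ^+ 2 * defect K0 lambda C t @[lambda --> +oo] --> Zlim C t.
Proof.
move=> Rmin0 regC gen; have [z fz] := exists_first_hit regC gen.
have [Cz cz _] := fz; have [rho0 rC _ _] := regC.
have r0 : 0 < z.2 by exact: lt_trans (rC _ Cz).
have -> : Zlim C t =
    - (hit t z ^+ 2 / 2) * (cos (2 * (z.1.2 - t)) / (z.2 * cos (z.1.2 - t))).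
  by rewrite /Zlim /L /Upsilon /Theta /Radius (edge_mark_first_hit regC fz).
apply: cvg_trans (cvg_scaled_gap (ltW (rho0 _ Cz)) r0 cz).
apply: near_eq_cvg; near=> l; congr (_ * _).
rewrite /defect (dist0_crofton regC fz); congr (_ - _); apply/esym.
by near: l; exact: near_dist0_scaled regC fz.
Unshelve. all: by end_near. Qed.

End deterministic.

(** * Almost sure properties of Poisson processes *)
Section poisson_process.
Context {R : realType} {d d' : measure_display} {Omega : measurableType d}
  {T : measurableType d'} {P : probability Omega R} {S : set T}
  {nu : set T -> \bar R} {Z : Omega -> set T}.
Context (hZ : poisson_process_on P S nu Z).
Implicit Types (B : set T).

Lemma ae_probability1 (A : set Omega) (Q : Omega -> Prop) : measurable A ->
  P A = 1%E -> A `<=` Q -> {ae P, forall w, Q w}.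
Proof.
move=> mA PA AQ; exists (~` A); split; first exact: measurableC.
  by rewrite probability_setC// PA subee.
exact: subsetC.
Qed.

Lemma measurable_nb_points B (k : \bar R) : measurable B -> B `<=` S ->
  measurable (nb_points R Z B @^-1` [set k]).
Proof.
move=> mB BS; rewrite -[X in measurable X]setTI.
by apply: (ppp_measurable hZ) => //; exact: emeasurable_set1.
Qed.

Lemma nb_points_le1_eq B w k x y : nb_points R Z B w = k%:R%:E -> (k <= 1)%N ->
  Z w x -> B x -> Z w y -> B y -> x = y.
Proof.
rewrite /nb_points /counting; case: ifPn => [/asboolP fin|//] [/eqP].
rewrite eqr_nat => /eqP cardk k1 Zx Bx Zy By.
have xin : x \in fset_set (Z w `&` B) by rewrite in_fset_set//; exact: mem_set.
have yin : y \in fset_set (Z w `&` B) by rewrite in_fset_set//; exact: mem_set.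
move: k1; rewrite -cardk leq_eqVlt ltnS leqn0 cardfs_eq0.
move=> /orP[/cardfs1P[a ae]|/eqP e].
  by move: xin yin; rewrite ae !in_fset1 => /eqP -> /eqP ->.
by move: xin; rewrite e in_fset0.
Qed.

Lemma ppp_ae_empty B : measurable B -> B `<=` S -> nu B = 0%E ->
  {ae P, forall w, forall x, Z w x -> ~ B x}.
Proof.
move=> mB BS nuB; have [poi _] := ppp_poisson hZ mB BS.
apply: (ae_probability1 (A := nb_points R Z B @^-1` [set 0%:R%:E])).
- exact: measurable_nb_points.
- by rewrite (poi 0 nuB) /poisson_prob ltxx diracE mem_set.
- move=> w; rewrite /= /nb_points /counting.
  case: ifPn => [/asboolP fin|//] [/eqP].
  rewrite pnatr_eq0 cardfs_eq0 => /eqP e x Zx Bx.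
  have : x \in fset_set (Z w `&` B) by rewrite in_fset_set//; exact: mem_set.
  by rewrite e in_fset0.
Qed.

Lemma ppp_ae_nonempty B : measurable B -> B `<=` S -> nu B = +oo%E ->
  {ae P, forall w, exists2 x, Z w x & B x}.
Proof.
move=> mB BS nuB; have [_ poi] := ppp_poisson hZ mB BS.
apply: (ae_probability1 (A := nb_points R Z B @^-1` [set +oo%E])).
- exact: measurable_nb_points.
- exact: poi.
- move=> w; rewrite /= /nb_points /counting; case: ifPn => // /asboolP inf _.
  have [e|/set0P[x [Zx Bx]]] := eqVneq (Z w `&` B) set0; last by exists x.
  by case: inf; rewrite e; exact: finite_set0.
Qed.

Lemma ppp_ae_finite B (r : R) : measurable B -> B `<=` S -> nu B = r%:E ->
  {ae P, forall w, finite_set [set x | Z w x /\ B x]}.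
Proof.
move=> mB BS nuB; have [poi _] := ppp_poisson hZ mB BS.
pose A k := nb_points R Z B @^-1` [set k%:R%:E].
have mA k : measurable (A k) by exact: measurable_nb_points.
apply: (ae_probability1 (A := \bigcup_k A k)).
- exact: bigcup_measurable.
- rewrite measure_bigcup//; last first.
    apply/trivIsetP => i j _ _ ij; apply/seteqP; split => // w [/= wi wj].
    have := etrans (esym wi) wj => -[/eqP].
    by rewrite eqr_nat; exact/negP.
  rewrite (eq_eseriesr (g := fun k => poisson_prob r 0 [set k])); last first.
    by move=> k _; exact: poi.
  rewrite -[RHS](@probability_setT _ _ _ (poisson_prob r 0)).
  rewrite [in RHS](_ : [set: nat] = \bigcup_k [set k]); last first.
    by rewrite bigcup_imset1 image_id.
  rewrite measure_bigcup//; apply/trivIsetP => i j _ _ ij.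
  by apply/seteqP; split => // w [/= -> /eqP]; rewrite (negPf ij).
- move=> w [k _]; rewrite /A /= /nb_points /counting.
  by case: ifPn => // /asboolP.
Qed.

(** Since exp (- r) >= 1 - r, the sum exp (- r) (1 + r) is at least
    (1 - r) (1 + r). *)
Lemma poisson_prob01_ge (r : R) : (1 - (r ^+ 2)%:E <=
  poisson_prob r 0 [set 0%N] + poisson_prob r 0 [set 1%N])%E.
Proof.
rewrite /poisson_prob; case: ifPn => r0.
  rewrite !esum_set1 ?lee_fin ?poisson_pmf_ge0// /poisson_pmf r0.
  rewrite expr0 expr1 fact0 invr1 !mul1r mulr1.
  have := expR_ge1Dx (- r) => h.
  rewrite (_ : 1 - r ^+ 2 = (1 + r) * (1 - r)); last by ring.
  rewrite -[leRHS](_ : (1 + r) * expR (- r) = _); last by rewrite mulrDl mul1r.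
  by rewrite ler_wpM2l// addr_ge0// ltW.
rewrite !diracE mem_set//= memNset//= adde0 -EFinB lee_fin gerBl sqr_ge0//.
Qed.

(** [P (N = 0) + P (N = 1) >= 1 - r ^ 2] for the number [N] of points in [B],
    and [F] is the complementary event. *)
Lemma ppp_several_points B (r : R) : measurable B -> B `<=` S -> nu B = r%:E ->
  exists F : set Omega, [/\ measurable F, (P F <= (r ^+ 2)%:E)%E &
    forall w, ~ F w -> forall x y, Z w x -> B x -> Z w y -> B y -> x = y].
Proof.
move=> mB BS nuB; have [poi _] := ppp_poisson hZ mB BS.
pose A k := nb_points R Z B @^-1` [set k%:R%:E].
have mA k : measurable (A k) by exact: measurable_nb_points.
exists (~` (A 0%N `|` A 1%N)); split.
- by apply/measurableC/measurableU.
- have -> : P (~` (A 0%N `|` A 1%N)) =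
      (1 - (poisson_prob r 0 [set 0%N] + poisson_prob r 0 [set 1%N]))%E.
    rewrite probability_setC; last exact: measurableU.
    rewrite measureU//; first by congr (_ - (_ + _))%E; exact: poi.
    apply/seteqP; split => // w [/= w0 w1].
    have := etrans (esym w0) w1 => -[/eqP].
    by rewrite eqr_nat.
  rewrite leeBlDr ?fin_numD; last by rewrite !fin_num_measure.
  by rewrite addeC -leeBlDr//; exact: poisson_prob01_ge.
- move=> w /contrapT[Aw|Aw] x y; exact: nb_points_le1_eq Aw _.
Qed.

End poisson_process.

(** * The intensity measure of boxes and strips *)
Section intensity.
Context {R : realType} (mu : probability (measurableTypeR R) R).
Implicit Types (A : set (R * R)) (t a b : R).
Local Open Scope ereal_scope.

Local Notation leb := (@lebesgue_measure R).

Lemma intensity_setX A (B : set R) : measurable A -> measurable B ->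
  intensity mu (A `*` B) = (leb \x leb) A * mu B.
Proof.
exact: (@product_measure1E _ _ _ _ R (leb \x leb) mu).
Qed.

Lemma intensity_box (A B D : set R) : measurable A -> measurable B ->
  measurable D -> intensity mu (A `*` B `*` D) = leb A * leb B * mu D.
Proof.
move=> mA mB mD; rewrite intensity_setX//; last exact: measurableX.
by congr (_ * _); exact: (@product_measure1E _ _ _ _ R leb leb).
Qed.

Lemma lebesgue_plane_le A (c : R) : measurable A -> (0 <= c)%R ->
  (forall rho theta, A (rho, theta) -> (0 <= theta < pi *+ 2)%R) ->
  (forall theta, leb (ysection A theta) <= c%:E) ->
  (leb \x leb) A <= (c * (pi *+ 2))%:E.
Proof.
move=> mA c0 A2pi Ac.
have -> : (leb \x leb) A = \int[leb]_y leb (ysection A y).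
  apply: (@product_measure_unique _ _ _ _ R leb leb (leb \x^ leb) _ A mA).
  exact: product_measure2E.
pose D : set R := `[0%R, (pi *+ 2)%R[%classic.
have mD : measurable D by exact: measurable_itv.
have pi2 : (0 < pi *+ 2 :> R)%R by rewrite mulrn_wgt0// pi_gt0.
have -> : \int[leb]_y leb (ysection A y) =
    \int[leb]_(y in D) leb (ysection A y).
  rewrite [RHS]integral_mkcond; apply: eq_integral => y _; rewrite patchE.
  case: ifPn => // /negP yD; rewrite (_ : ysection A y = set0) ?measure0//.
  apply/seteqP; split => // x; rewrite /ysection /= => /set_mem /A2pi yd.
  by apply: yD; apply: mem_set; rewrite /D /= in_itv.
apply: (@le_trans _ _ (\int[leb]_(y in D) c%:E)).
  apply: ge0_le_integral => //; apply: measurable_funTS.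
  exact: (@measurable_fun_ysection _ _ _ _ R leb A mA).
have lebD : leb D = (pi *+ 2)%:E.
  by rewrite lebesgue_measure_itv /= lte_fin pi2 oppr0 adde0.
by rewrite integral_cst// [X in _ * X <= _]lebD EFinM.
Qed.

Local Open Scope ring_scope.

Lemma measurable_bool_set d (T : measurableType d) (f : T -> bool) :
  measurable_fun setT f -> measurable [set x | f x].
Proof.
move=> mf; rewrite (_ : [set x | f x] = setT `&` f @^-1` [set true]).
  exact: mf.
by rewrite setTI.
Qed.

(** The pairs (rho, theta) of the lines hit in direction [t] at a distance
    from [a] to [b], written without division. *)
Definition strip t a b : set (R * R) :=
  (`[0, +oo[%classic `*` `[0, pi *+ 2[%classic) `&`
  [set x | 0 < cos (x.2 - t) /\ a * cos (x.2 - t) <= x.1 < b * cos (x.2 - t)].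

Lemma measurable_strip t a b : measurable (strip t a b).
Proof.
apply: measurableI; first by apply: measurableX; exact: measurable_itv.
have mcos : measurable_fun setT (fun x : R * R => cos (x.2 - t)).
  have mc : measurable_fun setT (@cos R).
    by apply: continuous_measurable_fun; exact: continuous_cos.
  apply: (measurableT_comp mc).
  by apply: measurable_funB => //; exact: measurable_snd.
have mM c : measurable_fun setT (fun x : R * R => c * cos (x.2 - t)).
  exact: measurable_funM.
have mfst : measurable_fun setT (fun x : R * R => x.1) by exact: measurable_fst.
rewrite (_ : [set x | _] = [set x : R * R | 0 < cos (x.2 - t)] `&`
    ([set x | a * cos (x.2 - t) <= x.1] `&` [set x | x.1 < b * cos (x.2 - t)])).
  apply: measurableI; first exact/measurable_bool_set/measurable_fun_ltr.
  apply: measurableI; apply: measurable_bool_set.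
    exact: measurable_fun_ler.
  exact: measurable_fun_ltr.
apply/seteqP; split => x /= [c0].
  by move=> /andP[].
by move=> [-> ->].
Qed.

(** At fixed theta, rho ranges over an interval of length (b - a) cos
    (theta - t), at most b - a. *)
Lemma strip_intensity_le t a b : mu `[0, +oo[%classic = 1%E -> a <= b ->
  (intensity mu (strip t a b `*` `[0%R, +oo[%classic) <=
   ((b - a) * (pi *+ 2))%:E)%E.
Proof.
move=> mu1 ab; have mI := @measurable_itv R `[0, +oo[.
rewrite (intensity_setX (measurable_strip t a b) mI) [mu _]mu1 mule1.
apply: lebesgue_plane_le.
- exact: measurable_strip.
- by rewrite subr_ge0.
- by move=> rho theta [[_ /=]]; rewrite in_itv.
- move=> theta; set c := cos (theta - t).
  pose i := if 0 < c then `[a * c, b * c[ else `]0, 0[.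
  have sub : ysection (strip t a b) theta `<=` [set` i].
    move=> rho; rewrite /ysection /= => /set_mem[_ /= [c0 abc]].
    by rewrite /i /c c0 /= in_itv.
  apply: (@le_trans _ _ (leb [set` i])).
    apply: le_measure => //; apply: mem_set; last exact: measurable_itv.
    exact: measurable_ysection (measurable_strip _ _ _).
  rewrite lebesgue_measure_itv /i; case: (ltP 0 c) => c0 /=; rewrite lte_fin.
    case: ifPn => _; last by rewrite lee_fin subr_ge0.
    by rewrite -EFinB lee_fin -mulrBl ler_piMr ?subr_ge0// /c cos_le1.
  by rewrite ltxx lee_fin subr_ge0.
Qed.

End intensity.

(** * Almost sure regularity of the marks *)
Section poisson_marks.
Context {R : realType} {mu : probability (measurableTypeR R) R}
  {d : measure_display} {Omega : measurableType d} {P : probability Omega R}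
  {Z : Omega -> set (R * R * R)}.
Context (mu1 : mu `[0, +oo[%classic = 1%E)
  (hZ : poisson_process_on P mark_space (intensity mu) Z).
Implicit Types (A B D : set R) (t : R).

Local Notation nonneg := (`[0, +oo[%classic).
Local Notation angles := (`[0, pi *+ 2[%classic).

Lemma measurable_box A B D : measurable A -> measurable B -> measurable D ->
  measurable (A `*` B `*` D).
Proof. by move=> mA mB mD; do 2!apply: measurableX => //. Qed.

Lemma box_mark_space A B D : A `<=` nonneg -> B `<=` angles -> D `<=` nonneg ->
  A `*` B `*` D `<=` mark_space.
Proof. by move=> hA hB hD z [[/hA ? /hB ?] /hD ?]; split. Qed.

Lemma ae_rho_gt0 : {ae P, forall w, forall z, Z w z -> 0 < z.1.1}.
Proof.
have mB := measurable_box (measurable_set1 (0 : R))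
  (measurable_itv `[0, pi *+ 2[) (measurable_itv `[0, +oo[).
have BS : ([set 0] `*` angles `*` nonneg) `<=` @mark_space R.
  by apply: box_mark_space => // x /= ->; rewrite in_itv/= lexx.
have := ppp_ae_empty hZ mB BS.
rewrite (intensity_box mu (measurable_set1 _) (measurable_itv _)
  (measurable_itv _)) lebesgue_measure_set1 !mul0e.
move=> /(_ erefl); apply: filterS => w none z Zz.
have [[z1 z2] z3] := ppp_sub hZ Zz.
move: (z1); rewrite /= in_itv/= andbT le_eqVlt => /orP[/eqP z0|//].
by case: (none _ Zz); split => //; split => //; exact/esym.
Qed.

Lemma ae_radius_gt Rmin : 0 < Rmin -> mu `]Rmin, +oo[%classic = 1%E ->
  {ae P, forall w, forall z, Z w z -> Rmin < z.2}.
Proof.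
move=> Rmin0 muR.
have mB := measurable_box (measurable_itv `[0, +oo[)
  (measurable_itv `[0, pi *+ 2[) (measurable_itv `[0, Rmin]).
have BS : (nonneg `*` angles `*` `[0, Rmin]%classic) `<=` @mark_space R.
  by apply: box_mark_space => // x /=; rewrite !in_itv/= => /andP[->].
have mu0 : mu `[0, Rmin]%classic = 0%E.
  have : (mu (~` `]Rmin, +oo[%classic) = 0)%E.
    rewrite probability_setC; last exact: measurable_itv.
    by rewrite [X in (1 - X)%E]muR subee.
  apply: subset_measure0.
  - exact: measurable_itv.
  - by apply: measurableC; exact: measurable_itv.
  - by move=> x /=; rewrite !in_itv/= andbT => /andP[_ xR]; apply/negP;
      rewrite -leNgt.
have := ppp_ae_empty hZ mB BS.
rewrite (intensity_box mu (measurable_itv _) (measurable_itv _)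
  (measurable_itv _)) mu0 mule0.
move=> /(_ erefl); apply: filterS => w none z Zz.
have [[z1 z2] z3] := ppp_sub hZ Zz.
rewrite ltNge; apply/negP => zR; apply: (none _ Zz); split => //=.
by move: z3; rewrite /= !in_itv/= andbT => ->.
Qed.

Lemma ae_locally_finite : {ae P, forall w, forall M : R,
  finite_set [set z | Z w z /\ z.1.1 <= M]}.
Proof.
have : {ae P, forall w, forall k : nat, finite_set [set z | Z w z /\
    (`[0, k.+1%:R]%classic `*` angles `*` nonneg) z]}.
  apply: ae_foralln => k.
  have mB := measurable_box (measurable_itv `[0 : R, k.+1%:R])
    (measurable_itv `[0, pi *+ 2[) (measurable_itv `[0, +oo[).
  have BS : (`[0, k.+1%:R]%classic `*` angles `*` nonneg) `<=` @mark_space R.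
    by apply: box_mark_space => // x /=; rewrite !in_itv/= => /andP[->].
  apply: (ppp_ae_finite hZ mB BS (r := k.+1%:R * (pi *+ 2))).
  rewrite (intensity_box mu (measurable_itv _) (measurable_itv _)
    (measurable_itv _)) mu1 mule1.
  rewrite !lebesgue_measure_itv /= !lte_fin ltr0n mulrn_wgt0 ?pi_gt0//.
  by rewrite !oppr0 !adde0.
apply: filterS => w fin M.
apply: sub_finite_set (fin (Num.Def.archi_bound `|M|)) => z [Zz zM].
split => //; have [[z1 z2] z3] := ppp_sub hZ Zz; split => //; split => //.
move: z1; rewrite /= !in_itv/= andbT => -> /=.
rewrite (le_trans zM)// (le_trans (ler_norm _))// ltW//.
by rewrite (lt_trans (archi_boundP _))// ltr_nat.
Qed.

(** The angles near [theta0] with all the values of rho form a set of infinite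
    intensity. *)
Lemma ae_angle_near (f : R -> R) (c theta0 : R) : continuous f ->
  0 <= theta0 < pi *+ 2 -> c < f theta0 ->
  {ae P, forall w, exists2 z, Z w z & c < f z.1.2}.
Proof.
move=> cf /andP[th0 th2pi] cth.
have /cvg_at_right_filter/cvgr_gt/(_ _ cth)[e /= e0 eP] := cf theta0.
pose th1 := Num.min (theta0 + e) (pi *+ 2).
have th01 : theta0 < th1 by rewrite lt_min th2pi andbT ltrDl.
have mB := measurable_box (measurable_itv `[0, +oo[)
  (measurable_itv `]theta0, th1[) (measurable_itv `[0, +oo[).
have BS : (nonneg `*` `]theta0, th1[%classic `*` nonneg) `<=` @mark_space R.
  apply: box_mark_space => // x /=; rewrite !in_itv/= lt_min => /and3P[a b c'].
  by rewrite c' (le_trans th0)// ltW.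
have : intensity mu (nonneg `*` `]theta0, th1[%classic `*` nonneg) = +oo%E.
  rewrite (intensity_box mu (measurable_itv _) (measurable_itv _)
    (measurable_itv _)) mu1 mule1.
  rewrite !lebesgue_measure_itv /= lte_fin th01 ltry oppr0 adde0.
  rewrite -EFinB gt0_mulye//.
  by rewrite lte_fin subr_gt0.
move=> /(ppp_ae_nonempty hZ mB BS); apply: filterS => w [z Zz [[_ /= zth] _]].
exists z => //; move: zth; rewrite in_itv/= lt_min => /and3P[a b _].
by apply: eP => //=; rewrite ltr0_norm ?subr_lt0// opprB ltrBlDl.
Qed.

(** One coordinate of [x] has the sup norm M as absolute value. For the mark
    whose normal exceeds 0.9 along this axis, with the sign of the coordinate,
    this coordinate contributes at least 0.9 M; the other component of the
    normal is at most 1/2, so the other coordinate removes at most M / 2. *)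
Lemma four_directions_spread (C : set (R * R * R)) :
  (forall z, C z -> 0 < z.1.1) ->
  (exists2 z, C z & 9 / 10 < cos z.1.2) ->
  (exists2 z, C z & 9 / 10 < sin z.1.2) ->
  (exists2 z, C z & 9 / 10 < - cos z.1.2) ->
  (exists2 z, C z & 9 / 10 < - sin z.1.2) -> spread C.
Proof.
move=> rho0 [a Ca ha] [b Cb hb] [c Cc hc] [e Ce he].
have small (u v : R) : u ^+ 2 + v ^+ 2 = 1 -> 9 / 10 < u -> `|v| <= 1 / 2.
  move=> uv hu; rewrite -(@ler_pXn2r _ 2)// ?nnegrE//.
  by rewrite real_normK ?num_real//; nra.
have key (u v p q : R) : 0 <= p -> `|q| <= p -> u ^+ 2 + v ^+ 2 = 1 ->
    9 / 10 < u -> 2 / 5 * p <= p * u + q * v.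
  move=> p0 qp uv hu; have hv := small _ _ uv hu.
  have : `|q * v| <= p * (1 / 2) by rewrite normrM ler_pM.
  rewrite ler_norml => /andP[h _].
  have : p * (9 / 10) <= p * u by rewrite ler_wpM2l// ltW.
  lra.
have cs (th : R) : cos th ^+ 2 + sin th ^+ 2 = 1 by exact: cos2Dsin2.
have := (rho0 _ Ca, rho0 _ Cb, rho0 _ Cc, rho0 _ Ce) => -[[[ra rb] rc] re].
exists (a.1.1 + b.1.1 + c.1.1 + e.1.1) => x; rewrite prod_normE /dircoord /=.
have [x12|x21] := leP `|x.2| `|x.1|.
  have [x0|x0] := leP 0 x.1.
    exists a; split => //; first lra.
    by rewrite ger0_norm//; apply: key => //; rewrite -(ger0_norm x0).
  exists c; split => //; first lra.
  rewrite ltr0_norm// -(mulrNN x.1) -(mulrNN x.2); apply: key => //.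
  - by rewrite oppr_ge0 ltW.
  - by rewrite normrN -(ltr0_norm x0).
  - by rewrite !sqrrN.
have [x0|x0] := leP 0 x.2.
  exists b; split => //; first lra.
  rewrite ger0_norm// addrC; apply: key => //; last by rewrite addrC.
  by rewrite -(ger0_norm x0) ltW.
exists e; split => //; first lra.
rewrite ltr0_norm// addrC -(mulrNN x.1) -(mulrNN x.2); apply: key => //.
- by rewrite oppr_ge0 ltW.
- by rewrite normrN -(ltr0_norm x0) ltW.
- by rewrite !sqrrN addrC.
Qed.

Lemma ae_regular Rmin : 0 < Rmin -> mu `]Rmin, +oo[%classic = 1%E ->
  {ae P, forall w, regular Rmin (Z w)}.
Proof.
move=> Rmin0 muR.
have pi0 := pi_gt0 R.
near=> w.
have rho0 : forall z, Z w z -> 0 < z.1.1 by near: w; exact: ae_rho_gt0.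
split => //.
- by near: w; exact: ae_radius_gt.
- by near: w; exact: ae_locally_finite.
apply: four_directions_spread => //.
- near: w; apply: (ae_angle_near (f := cos) (theta0 := 0)).
  + exact: continuous_cos.
  + by rewrite lexx mulrn_wgt0.
  + by rewrite cos0; lra.
- near: w; apply: (ae_angle_near (f := sin) (theta0 := pi / 2)).
  + exact: continuous_sin.
  + by rewrite -mulr_natl; apply/andP; split; lra.
  + by rewrite sin_pihalf; lra.
- near: w; apply: (ae_angle_near (f := fun x => - cos x) (theta0 := pi)).
  + by move=> x; apply: cvgN; exact: continuous_cos.
  + by rewrite -mulr_natl; apply/andP; split; lra.
  + by rewrite cospi; lra.
- near: w.
  apply: (ae_angle_near (f := fun x => - sin x) (theta0 := pi / 2 + pi)).
  + by move=> x; apply: cvgN; exact: continuous_sin.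
  + by rewrite -mulr_natl; apply/andP; split; lra.
  + by rewrite sinDpi sin_pihalf; lra.
Unshelve. all: by end_near. Qed.

(** A tie below M puts two points in one strip of width 1 / (k + 1), for each
    k; there are M (k + 1) such strips, each of intensity at most
    2 pi / (k + 1). *)
Lemma ae_generic_direction_below t (M : nat) :
  {ae P, forall w, forall z z', Z w z -> Z w z' ->
    0 < cos (z.1.2 - t) -> 0 < cos (z'.1.2 - t) -> hit t z = hit t z' ->
    hit t z < M%:R -> z = z'}.
Proof.
pose B (k j : nat) : set (R * R * R) :=
  strip t (j%:R / k.+1%:R) (j.+1%:R / k.+1%:R) `*` `[0, +oo[%classic.
have /choice[F FP] : forall kj : nat * nat, exists F : set Omega,
  [/\ measurable F, (P F <= ((pi *+ 2 / kj.1.+1%:R) ^+ 2)%:E)%E &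
    forall w, ~ F w -> forall x y, Z w x -> B kj.1 kj.2 x ->
      Z w y -> B kj.1 kj.2 y -> x = y].
  move=> [k j] /=.
  have mB : measurable (B k j).
    by apply: measurableX; [exact: measurable_strip|exact: measurable_itv].
  have BS : B k j `<=` mark_space by move=> z [[]].
  have k0 : (0 : R) < k.+1%:R by rewrite ltr0n.
  have le : (intensity mu (B k j) <= (pi *+ 2 / k.+1%:R)%:E)%E.
    apply: (le_trans (strip_intensity_le t mu1 _)).
      by rewrite ler_pM2r ?invr_gt0// ler_nat.
    by rewrite lee_fin -mulrBl -natrB ?leqnSn// subSnn mul1r mulrC.
  have ge0 : (0 <= intensity mu (B k j))%E by exact: measure_ge0.
  have fin : intensity mu (B k j) \is a fin_num.
    by rewrite ge0_fin_numE// (le_lt_trans le)// ltry.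
  have [G [mG PG GP]] := ppp_several_points hZ mB BS (esym (fineK fin)).
  exists G; split => //; rewrite (le_trans PG)// lee_fin lerXn2r ?nnegrE//.
  - by rewrite fine_ge0.
  - by rewrite divr_ge0// mulrn_wge0// pi_ge0.
  - by rewrite -lee_fin fineK.
(* [G k] contains every outcome with a tie below [M] *)
pose G k := \big[setU/set0]_(j < M * k.+1) F (k, nat_of_ord j).
have mG k : measurable (G k).
  by apply: bigsetU_measurable => j _; have [] := FP (k, nat_of_ord j).
have PG k : (P (G k) <= (M%:R * (pi *+ 2) ^+ 2 / k.+1%:R)%:E)%E.
  have mF j : (j < M * k.+1)%N -> measurable (F (k, j)) by have [] := FP (k, j).
  apply: (le_trans (Boole_inequality P mF)).
  apply: (@le_trans _ _ (\sum_(j < M * k.+1) ((pi *+ 2 / k.+1%:R) ^+ 2)%:E)%E).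
    by apply: lee_sum => j _; have [] := FP (k, nat_of_ord j).
  rewrite sumEFin sumr_const card_ord lee_fin -[leLHS]mulr_natl natrM le_eqVlt.
  by apply/orP; left; apply/eqP; field.
have mI : measurable (\bigcap_k G k) by exact: bigcap_measurable.
exists (\bigcap_k G k); split => //.
  apply/eqP; rewrite eq_le measure_ge0 andbT.
  have fin : P (\bigcap_k G k) \is a fin_num by exact: fin_num_measure.
  rewrite -(fineK fin) lee_fin leNgt; apply/negP => p0.
  set p := fine _ in p0.
  pose k := Num.Def.archi_bound (M%:R * (pi *+ 2) ^+ 2 / p).
  have : p <= M%:R * (pi *+ 2) ^+ 2 / k.+1%:R.
    rewrite -lee_fin /p fineK// (le_trans _ (PG k))// le_measure ?mem_set//.
    exact: bigcap_inf.
  apply/negP; rewrite -ltNge ltr_pdivrMr ?ltr0n// [p * _]mulrC -ltr_pdivrMr//.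
  have := @archi_boundP R (M%:R * (pi *+ 2) ^+ 2 / p); rewrite -/k => kP.
  rewrite (lt_trans (kP _)) ?ltr_nat//.
  by rewrite divr_ge0 ?(ltW p0)// mulr_ge0// sqr_ge0.
move=> w /= /existsNP[z]; apply: contra_notP => /existsNP[k /not_implyP[_ nG]].
move=> z' Zz Zz' cz cz' hh hM.
have nF j : (j < M * k.+1)%N -> ~ F (k, j) w.
  move=> jM Fw; apply: nG.
  by rewrite /G -(bigcup_mkord _ (fun i => F (k, i))); exists j.
have [[/= z1 z2] z3] := ppp_sub hZ Zz.
have [[/= z1' z2'] z3'] := ppp_sub hZ Zz'.
have h0 : 0 <= hit t z.
  by rewrite divr_ge0 ?(ltW cz)//; move: z1; rewrite in_itv/= andbT.
have k0 : (0 : R) < k.+1%:R by rewrite ltr0n.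
have hk0 : 0 <= hit t z * k.+1%:R by rewrite mulr_ge0.
pose j := Num.truncn (hit t z * k.+1%:R).
have /andP[jh hj] := truncn_itv hk0; rewrite -/j in jh hj.
have jM : (j < M * k.+1)%N.
  by rewrite -(ltr_nat R) (le_lt_trans jh)// natrM ltr_pM2r.
have inB y : 0 < cos (y.1.2 - t) -> mark_space y -> hit t y = hit t z ->
    B k j y.
  move=> cy [[/= y1 y2] y3] hy; split => //; split => //; split => //=.
  rewrite -hy in jh hj.
  rewrite -ler_pdivlMr// -ltr_pdivrMr// -/(hit t y).
  by rewrite ler_pdivrMr// jh ltr_pdivlMr.
have [_ _] := FP (k, j); move=> /(_ w (nF j jM)); by apply => //; apply: inB.
Qed.

Lemma ae_generic_direction t : {ae P, forall w, generic_direction (Z w) t}.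
Proof.
have := ae_foralln (ae_generic_direction_below t).
apply: filterS => w gen z z' Zz Zz' cz cz' hh.
apply: (gen (Num.Def.archi_bound `|hit t z|)) => //.
by rewrite (le_lt_trans (ler_norm _))// archi_boundP.
Qed.

End poisson_marks.

Lemma cvg_row (R : realType) (U : Type) (F : set_system U) {FF : Filter F}
    (n : nat) (f : 'I_n -> U -> R) (l : 'I_n -> R) :
  (forall i, f i x @[x --> F] --> l i) ->
  (\row_(i < n) f i x) @[x --> F] --> \row_(i < n) l i.
Proof.
move=> fl A [/= P lP PA].
have : \forall x \near F, forall i, P ord0 i (f i x).
  apply: filter_forall => i; apply: fl; have := lP ord0 i; by rewrite mxE.
by apply: filterS => x Px; apply: PA => i j; rewrite mxE ord1.
Qed.

(** * The theorem *)
Theorem theorem4p2 (R : realType)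
  (mu : probability (measurableTypeR R) R)
  (hmu_nneg : mu `[0, +oo[%classic = 1%E)
  (hmu_mean : (\int[mu]_(r in `[0%R, +oo[) r%:E = 1)%E)
  (hmu_sq : (\int[mu]_(r in `[0%R, +oo[) (r ^+ 2)%:E < +oo)%E)
  (hmu_supp : exists Rstar : R, 0 < Rstar /\ mu `]Rstar, +oo[%classic = 1%E)
  (d : measure_display) (Omega : measurableType d) (P : probability Omega R)
  (Z : Omega -> set (R * R * R))
  (hZ : poisson_process_on P mark_space (intensity mu) Z)
  (K0 : set (R * R)) (hK0 : compact K0)
  (n : nat) (hn : (1 <= n)%N) (t : 'I_n -> R)
  (ht : forall i, 0 <= t i < pi *+ 2)
  (ht_incr : forall i j : 'I_n, (i < j)%N -> t i < t j) :
  {ae P, forall w : Omega,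
    (\row_(i < n) (lambda ^+ 2 * defect K0 lambda (Z w) (t i)))
      @[lambda --> +oo] --> \row_(i < n) Zlim (Z w) (t i)}.
Proof.
have [Rmin [Rmin0 muR]] := hmu_supp.
have gen : \forall w \ae P, forall i, generic_direction (Z w) (t i).
  by apply: filter_forall => i; exact: ae_generic_direction hmu_nneg hZ _.
apply: filterS2 (ae_regular hmu_nneg hZ Rmin0 muR) gen => w reg genw.
by apply: cvg_row => i; exact: cvg_defect reg (genw i).
Qed.
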